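(* Let $d\ge1$, $n\ge d$, and let $0\le i_1<\dots<i_d\le n$ be any indices. (1) Let $S_k=X_1+\dots+X_k$, $1\le k\le n$, be the partial sums of $n$-exchangeable random vectors $X_1,\dots,X_n$ in $\mathbb R^d$, $S_0:=0$, and suppose that with probability one $S_1,\dots,S_n$ are in general position. Then $$\sum_{i=0}^{n-i_d+i_1}\mathbb P\bigl(\operatorname{conv}(S_i,S_{i+i_2-i_1},\dots,S_{i+i_d-i_1})\in\mathcal F_n\bigr)=\frac{2}{(i_2-i_1)\cdots(i_d-i_{d-1})}.$$ Moreover, if in addition $S_1,\dots,S_n,0$ is a random bridge of length $n+1$, then $$\mathbb P\bigl(\operatorname{conv}(S_{i_1},\dots,S_{i_d})\in\mathcal F_n\bigr)=\frac{2}{(i_2-i_1)\cdots(i_d-i_{d-1})\,(n-i_d+i_1+1)}.$$ (2) Let $S_k=X_1+\dots+X_k$, $S_0:=0$, be a random walk in $\mathbb R^d$ (that is, $X_1,X_2,\dots$ are i.i.d.) such that $\mathbb P(X_1\in h)=0$ for every affine hyperplane $h\subset\mathbb R^d$ and $X_1\overset{d}{=}-X_1$. Then $$\mathbb P\bigl(\operatorname{conv}(S_{i_1},\dots,S_{i_d})\in\mathcal F_n\bigr)=2\,\frac{(2i_1-1)!!}{(2i_1)!!}\,\frac{(2n-2i_d-1)!!}{(2n-2i_d)!!}\prod_{k=1}^{d-1}\frac1{i_{k+1}-i_k}.$$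
   Context: $C_n:=\operatorname{conv}(S_0,S_1,\dots,S_n)$ with $S_0=0$, and $\mathcal F_n$ is the set of all $(d-1)$-dimensional faces of the polytope $C_n$ (almost surely each face is a simplex $\operatorname{conv}(S_{j_1},\dots,S_{j_d})$ with $0\le j_1<\dots<j_d\le n$). Random vectors $X_1,\dots,X_n$ are $n$-exchangeable if $(X_{\sigma(1)},\dots,X_{\sigma(n)})$ has the same distribution as $(X_1,\dots,X_n)$ for every permutation $\sigma$ of $\{1,\dots,n\}$. Vectors $S_1,\dots,S_n$ in $\mathbb R^d$ are in general position if any $d$ of them are linearly independent. A random bridge of length $m$ is a sequence of partial sums $S_1,\dots,S_m$ of $m$-exchangeable random vectors such that $S_m=0$ almost surely. Empty products equal $1$. Double factorials: $(2m-1)!!=1\cdot3\cdots(2m-1)$, $(2m)!!=2\cdot4\cdots(2m)$, with $(-1)!!=0!!=1$. *)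

(* Defs.v *)
From HB Require Import structures.
From mathcomp Require Import all_boot all_order all_algebra perm.
From mathcomp Require Import all_classical all_reals all_analysis.

Set Implicit Arguments.
Unset Strict Implicit.
Unset Printing Implicit Defensive.

Import Order.TTheory GRing.Theory Num.Theory.
Import numFieldNormedType.Exports.

Local Open Scope classical_set_scope.
Local Open Scope ring_scope.

(* [R^d] is ['rV[R]_d] with its Borel sigma-algebra, generated by the
   coordinate maps; the library has this for [d.-tuple R] but not for
   matrices. *)
Section measurable_rV.
Context {R : realType} {d : nat}.

Let coors : 'I_d -> 'rV[R]_d -> R := fun j x => x ord0 j.

Let rV_set0 : g_sigma_preimage coors set0.
Proof. exact: sigma_algebra0. Qed.

Let rV_setC (A : set 'rV[R]_d) : 
  g_sigma_preimage coors A -> g_sigma_preimage coors (~` A).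
Proof. exact: sigma_algebraC. Qed.

Let rV_bigcup (F : (set 'rV[R]_d)^nat) :
  (forall i, g_sigma_preimage coors (F i)) ->
  g_sigma_preimage coors (\bigcup_i (F i)).
Proof. exact: sigma_algebra_bigcup. Qed.

HB.instance Definition _ := @isMeasurable.Build default_measure_display
  'rV[R]_d (g_sigma_preimage coors) rV_set0 rV_setC rV_bigcup.

End measurable_rV.

Section convex_polytopes.
Context {R : realType} {d : nat}.
Implicit Types (A C F : set 'rV[R]_d).

Definition conv_hull A : set 'rV[R]_d := smallest (@convex_set R 'rV[R]_d) A.

(* An affine hyperplane when [u != 0]. *)
Definition hyperplane (u : 'cV[R]_d) (c : R) : set 'rV[R]_d :=
  [set x | (x *m u) ord0 ord0 = c].

(* [u] may be [0], so that [C] itself and the empty set are faces; the empty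
   set has no dimension in the sense of [has_dim]. *)
Definition is_face C F :=
  exists (u : 'cV[R]_d) (c : R),
    (forall x, C x -> (x *m u) ord0 ord0 <= c) /\
    F = C `&` hyperplane u c.

(* [V] below is the direction of the affine hull of [A]. *)
Definition has_dim A (k : nat) :=
  A !=set0 /\
  exists V : {vspace 'rV[R]_d},
    [/\ \dim V = k,
        forall x y, A x -> A y -> x - y \in V &
        forall W : {vspace 'rV[R]_d},
          (forall x y, A x -> A y -> x - y \in W) -> (V <= W)%VS].

Definition faces (k : nat) C : set (set 'rV[R]_d) :=
  [set F | is_face C F /\ has_dim F k].

Definition general_position (n : nat) (S : nat -> 'rV[R]_d) :=
  forall J : 'I_d -> 'I_n, injective J ->
    row_free (\matrix_(k < d) S (J k).+1).

End convex_polytopes.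

(* Increments are indexed from 1: the value at 0 of a sequence of increments
   is never used, and the sums start from [psum X 0 = 0]. *)
Definition psum (T : Type) (V : zmodType) (X : nat -> T -> V)
    (k : nat) (w : T) : V :=
  \sum_(1 <= j < k.+1) X j w.

Section processes.
Context {R : realType} {d : nat} {disp : measure_display}.
Context {T : measurableType disp} (P : probability T R).

Definition same_law d' (U : measurableType d') (f g : T -> U) :=
  forall A : set U, measurable A -> P (f @^-1` A) = P (g @^-1` A).

Definition exchangeable (n : nat) (X : nat -> T -> 'rV[R]_d) :=
  forall s : 'S_n,
    same_law (fun w => [tuple X (s k).+1 w | k < n])
             (fun w => [tuple X k.+1 w | k < n]).

Definition random_bridge (m : nat) (S : nat -> T -> 'rV[R]_d) :=
  exists Y : nat -> {RV P >-> 'rV[R]_d},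
    [/\ exchangeable m Y,
        forall k, (1 <= k <= m)%N -> S k = psum Y k &
        {ae P, forall w, S m w = 0}].

Definition iid (X : nat -> T -> 'rV[R]_d) :=
  (forall k, (1 <= k)%N -> same_law (X k) (X 1%N)) /\
  (forall (s : seq nat) (B : nat -> set 'rV[R]_d),
     uniq s -> (forall k, k \in s -> (1 <= k)%N) ->
     (forall k, measurable (B k)) ->
     P (\bigcap_(k in [set` s]) X k @^-1` B k) =
     (\prod_(k <- s) P (X k @^-1` B k))%E).

Definition face_event (n : nat) (S : nat -> T -> 'rV[R]_d) (J : nat -> nat) :
    set T :=
  [set w | faces d.-1 (conv_hull [set S k w | k in [set k | (k <= n)%N]])
             (conv_hull [set S (J k) w | k in [set k | (1 <= k <= d)%N]])].

End processes.

(* [dfact 0 = dfact 1 = 1]; with truncated subtraction [dfact (2 * 0 - 1)]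
   is [dfact 0], which agrees with the convention [(-1)!! = 1]. *)
Fixpoint dfact (m : nat) : nat :=
  if m is k.+2 then (m * dfact k)%N else 1%N.

(* Main.v *)
Require Import Defs.
From HB Require Import structures.
From mathcomp Require Import all_boot all_order all_algebra perm.
From mathcomp Require Import all_classical all_reals all_analysis.
From mathcomp Require Import measurable_realfun.
From mathcomp Require Import ring lra zify.

Set Implicit Arguments.
Unset Strict Implicit.
Unset Printing Implicit Defensive.

Import Order.TTheory GRing.Theory Num.Theory.
Import numFieldNormedType.Exports.

Local Open Scope classical_set_scope.
Local Open Scope ring_scope.

(* Project the walk along the normal of the hyperplane through the d vertices.
   The d - 1 blocks of steps between consecutive vertices project to bridges,
   and the simplex is a facet iff, up to the sign of the normal, every block
   projects to a positive excursion and the walk formed by the remaining steps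
   has its strict minimum exactly where the blocks are inserted. The normal
   depends only on the sums over the blocks, so it is unaffected by cyclic
   shifts inside a block and by rearranging the other steps.
   Exactly one of the a cyclic shifts of a generic bridge of length a is a
   positive excursion, so by exchangeability the blocks contribute the product
   of the 1 / a, and the two signs of the normal contribute the factor 2.
   In (1), moving the blocks to the front reduces the sum over the starting
   index to the fact that the remaining walk has exactly one minimum; for a
   bridge, rotating the steps cyclically makes all the terms equal.
   In (2), let u(m) be the probability that a generic symmetric walk of m steps
   stays positive. Cutting the walk at its minimum and reversing and negating
   the first part gives sum_i u(i) u(m - i) = 1, hence
   u(m) = (2 m - 1)!! / (2 m)!!. *)

(** * Normals, simplices and facets *)

(** General position is assumed for one order of the steps, while cyclic shifts and minima need the
    projected walk to be free of ties. Ties are excluded by rearranging: a permutation of the steps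
    turns the increment between two points into a displacement between a vertex and another point,
    and its height vanishes only if too many points of a rearranged walk lie on one hyperplane.
    Genericity is therefore imposed on all rearrangements at once, which under exchangeability costs
    only a finite union of null sets. The normal depends on the whole configuration, so the
    projected blocks are not independent, and products of probabilities are obtained without
    conditioning: an event [D] that is stable under certain measure-preserving maps of the space of
    step tuples is partitioned into pieces whose measures these maps relate. The ambient dimension
    is written [d.+1], so that a facet has [d.+1] vertices and [d] edges. *)

Section height.
Context {R : realType} {d : nat}.
Implicit Types (u : 'cV[R]_d) (v w : 'rV[R]_d).

Definition height u v : R := (v *m u) ord0 ord0.

Lemma heightD u v w : height u (v + w) = height u v + height u w.
Proof. by rewrite /height mulmxDl mxE. Qed.

Lemma heightN u v : height u (- v) = - height u v.
Proof. by rewrite /height mulNmx mxE. Qed.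

Lemma heightB u v w : height u (v - w) = height u v - height u w.
Proof. by rewrite heightD heightN. Qed.

Lemma heightZ u a v : height u (a *: v) = a * height u v.
Proof. by rewrite /height -scalemxAl mxE. Qed.

Lemma heightNl u v : height (- u) v = - height u v.
Proof. by rewrite /height mulmxN mxE. Qed.

Lemma heightDl u u' v : height (u + u') v = height u v + height u' v.
Proof. by rewrite /height mulmxDr mxE. Qed.

Lemma heightZl u a v : height (a *: u) v = a * height u v.
Proof. by rewrite /height -scalemxAr mxE. Qed.

Lemma heightE u v : height u v = \sum_j v ord0 j * u j ord0.
Proof. by rewrite /height mxE. Qed.

Lemma height_tr_gt0 u : u != 0 -> 0 < height u u^T.
Proof.
move=> u0; rewrite heightE lt_neqAle sumr_ge0 ?andbT; last first.
  by move=> j _; rewrite mxE -expr2 sqr_ge0.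
apply: contra u0; rewrite eq_sym psumr_eq0; last first.
  by move=> j _; rewrite mxE -expr2 sqr_ge0.
move=> /allP u0; apply/eqP/matrixP => j k; rewrite (ord1 k) mxE.
have := u0 j (mem_index_enum _); rewrite /= mxE -expr2 sqrf_eq0.
by move/eqP.
Qed.

End height.

Section normal.
Context {R : realType} {d : nat}.
Implicit Types (v : 'rV[R]_d.+1) (B : nat -> 'rV[R]_d.+1) (u : 'cV[R]_d.+1).

(** Row 0 is a free slot and the other rows hold the edges [B 1], ..., [B d]; [B 0] is never read.
    As a function of [v] the determinant is the linear form given by the generalized cross product
    of the edges. *)
Definition frame v B : 'M[R]_d.+1 :=
  \matrix_(k < d.+1) (if k == ord0 then v else B k).

(* Only row 0 of the frame is set to [0], and the cofactors along row 0 do not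
   depend on it. *)
Definition normal B : 'cV[R]_d.+1 := \col_l cofactor (frame 0 B) ord0 l.

Lemma height_normal v B : height (normal B) v = \det (frame v B).
Proof.
rewrite heightE (expand_det_row _ ord0); apply: eq_bigr => j _.
rewrite !mxE /= /cofactor; congr (_ * (_ * \det _)).
by apply/matrixP => k l; rewrite !mxE eq_sym (negbTE (neq_lift _ _)).
Qed.

Lemma normal_orth B k : (1 <= k <= d)%N -> height (normal B) (B k) = 0.
Proof.
move=> /andP[k1 kd]; rewrite height_normal.
have kd' : (k < d.+1)%N by [].
apply: (@determinant_alternate _ _ _ ord0 (Ordinal kd')).
  by rewrite -val_eqE /= neq_ltn k1.
move=> j; rewrite !mxE /= -val_eqE /=.
by case: k k1 {kd kd'} => //.
Qed.

Lemma ord_neq0_range (k : 'I_d.+1) : k <> ord0 -> (1 <= k <= d)%N.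
Proof.
move=> k0; rewrite leq_ord andbT lt0n; apply/eqP => k0'.
by apply: k0; apply: val_inj.
Qed.

Lemma eq_normal B B' : (forall k, (1 <= k <= d)%N -> B k = B' k) ->
  normal B = normal B'.
Proof.
move=> BB'; apply/colP => l; rewrite !mxE; congr cofactor.
apply/row_matrixP => k; rewrite !rowK; case: eqP => // k0; apply: BB'.
exact: ord_neq0_range.
Qed.

Lemma det0_null m (A : 'M[R]_m) : \det A = 0 ->
  exists2 u : 'cV[R]_m, u != 0 & forall k, height u (row k A) = 0.
Proof.
move=> A0; have : \det A^T == 0 by rewrite det_tr A0.
move=> /det0P[v v0 vA]; exists v^T; first by rewrite trmx_eq0.
move=> k; have /(congr1 (fun M => M^T k ord0)) := vA.
by rewrite trmx_mul trmxK !mxE /height -row_mul mxE mxE.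
Qed.

Lemma det_neq0_null m (A : 'M[R]_m) (u : 'cV[R]_m) :
  \det A != 0 -> (forall k, height u (row k A) = 0) -> u = 0.
Proof.
move=> A0 uA; have Au : A *m u = 0.
  apply/colP => k; have := uA k; rewrite /height -row_mul mxE => ->.
  by rewrite mxE.
have Aunit : A \in unitmx by rewrite unitmxE unitfE.
by rewrite -(mulKmx Aunit u) Au mulmx0.
Qed.

(** The matrix with rows [(normal B)^T], [B 1], ..., [B d] has as determinant the squared norm of
    the normal, so only 0 is orthogonal to all its rows; this applies to [u] minus its orthogonal
    projection on the normal. *)
Lemma orth_normal B u : normal B != 0 ->
  (forall k, (1 <= k <= d)%N -> height u (B k) = 0) ->
  exists a, u = a *: normal B.
Proof.
move=> N0 uB; have NN := height_tr_gt0 N0.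
exists (height u (normal B)^T / height (normal B) (normal B)^T).
apply/eqP; rewrite -subr_eq0; apply/eqP.
apply: (@det_neq0_null _ (frame (normal B)^T B)).
  by rewrite -height_normal gt_eqF.
move=> k; rewrite rowK heightDl heightNl heightZl; case: eqP => k0.
  by rewrite divfK ?subrr// gt_eqF.
have k1 := ord_neq0_range k0.
by rewrite uB// normal_orth// mulr0 subrr.
Qed.

End normal.

(** * Convex hulls and barycentric coordinates *)

Section convex.
Context {R : realType} {d : nat}.
Implicit Types (A : set 'rV[R]_d) (u : 'cV[R]_d) (x y : 'rV[R]_d).

Lemma convex_setE A : @convex_set R 'rV[R]_d A <->
  forall x y (t : R), A x -> A y -> 0 <= t <= 1 -> A (t *: x + (1 - t) *: y).
Proof.
split=> [cA x y t Ax Ay t01|cA x y t]; last first.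
  rewrite !inE => Ax Ay; apply: cA => //.
  by apply/andP; split; [exact: ge0 | exact: le1].
move: t01 => /andP[t0 t1].
by have := cA x y (Itv01 t0 t1); rewrite !inE => /(_ Ax Ay).
Qed.

Lemma conv_hull_convex A x y (t : R) : conv_hull A x -> conv_hull A y ->
  0 <= t <= 1 -> conv_hull A (t *: x + (1 - t) *: y).
Proof.
move=> Ax Ay t01 C CA; have [/convex_setE cC _] := CA; apply: cC t01; [exact: Ax | exact: Ay].
Qed.

Lemma sub_conv_hull A : A `<=` conv_hull A.
Proof. by move=> x Ax C [_]; exact. Qed.

Lemma conv_hull_min A C :
  (forall x y (t : R), C x -> C y -> 0 <= t <= 1 -> C (t *: x + (1 - t) *: y)) ->
  A `<=` C -> conv_hull A `<=` C.
Proof. by move=> /convex_setE cC AC x; apply; split. Qed.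

Lemma conv_hull_sum A m (l : 'I_m -> R) (p : 'I_m -> 'rV[R]_d) :
  (forall k, 0 <= l k) -> \sum_k l k = 1 -> (forall k, A (p k)) ->
  conv_hull A (\sum_k l k *: p k).
Proof.
elim: m l p => [|m IH] l p l0.
  by rewrite big_ord0 => /eqP; rewrite eq_sym oner_eq0.
rewrite !big_ord_recr /= => l1 Ap.
set s := (X in X + _ = 1) in l1.
have s0 : 0 <= s by rewrite /s sumr_ge0.
(* If the first [m] weights vanish they cannot be renormalised by [s]; the sum is then the last
   point. *)
have [s0'|s0'] := eqVneq s 0.
  have lz k : l (widen_ord (leqnSn m) k) = 0.
    by move/eqP : s0'; rewrite psumr_eq0// => /allP/(_ k (mem_index_enum _))/eqP.
  rewrite big1 ?add0r; last by move=> k _; rewrite lz scale0r.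
  rewrite s0' add0r in l1; rewrite l1 scale1r; by apply: sub_conv_hull.
have -> : \sum_(i < m) l (widen_ord (leqnSn m) i) *: p (widen_ord (leqnSn m) i) =
   s *: \sum_(i < m) (l (widen_ord (leqnSn m) i) / s) *: p (widen_ord (leqnSn m) i).
  by rewrite scaler_sumr; apply: eq_bigr => i _; rewrite scalerA mulrC divfK.
have -> : l ord_max = 1 - s by rewrite -l1 addrAC subrr add0r.
apply: conv_hull_convex.
- apply: IH => //; first by move=> k; rewrite divr_ge0.
  by rewrite -mulr_suml divff.
- by apply: sub_conv_hull.
- by rewrite s0 /= -[leRHS]l1 lerDl.
Qed.

Lemma conv_hull_half A u c :
  (forall x, A x -> height u x <= c) -> forall x, conv_hull A x -> height u x <= c.
Proof.
move=> Ac; apply: (conv_hull_min (C := [set x | height u x <= c])) => //=.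
move=> x y t xc yc /andP[t0 t1]; rewrite heightD !heightZ.
by nra.
Qed.

End convex.

Section simplex.
Context {R : realType} {d : nat}.
Implicit Types (v w : 'rV[R]_d.+1) (B : nat -> 'rV[R]_d.+1).

(* Cleared of denominators: [bary B v k / bary B v 0] is the coefficient of
   [B k] in [v], for [1 <= k <= d]. With [B k] the [k]-th edge, the barycentric
   weight of the vertex [k + 1] is proportional to
   [bary B v k - bary B v k.+1]. *)
Definition bary B v (k : nat) : R :=
  let M := frame (normal B)^T B in
  if k == 0%N then \det M
  else if (k <= d)%N then (v *m \adj M) ord0 (inord k) else 0.

(** The values [\det M] at 0 and 0 at [d.+1] make the first and last barycentric weights consecutive
    differences as well. For a nonzero normal [\det M] is its squared norm, so clearing denominators
    keeps the signs. *)
Definition in_simplex B v := forall k, (k <= d)%N -> bary B v k.+1 <= bary B v k.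

Lemma bary_conv B v w (t : R) k :
  bary B (t *: v + (1 - t) *: w) k = t * bary B v k + (1 - t) * bary B w k.
Proof.
rewrite /bary; case: ifP => _; first by rewrite -mulrDl addrC subrK mul1r.
case: ifP => _; last by rewrite !mulr0 addr0.
by rewrite mulmxDl -!scalemxAl !mxE.
Qed.

(** When the [B j] are successive edges, the sum is the vertex [m + 1] seen from the first one. *)
Lemma sum_bary B m k : (m <= d)%N -> (1 <= k <= d)%N ->
  bary B (\sum_(1 <= j < m.+1) B j) k =
  (k <= m)%N%:R * \det (frame (normal B)^T B).
Proof.
move=> md /andP[k1 kd]; rewrite /bary gtn_eqF// kd mulmx_suml summxE.
set M := frame _ _.
have BM j : (1 <= j < m.+1)%N ->
    (B j *m \adj M) ord0 (inord k) = (j == k)%:R * \det M.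
  move=> /andP[j1 jm]; have jd : (j < d.+1)%N by apply: leq_trans jm _.
  have -> : B j = row (Ordinal jd) M.
    by rewrite rowK; case: eqP => // /(congr1 val)/= j0; rewrite j0 in j1.
  rewrite -row_mul mul_mx_adj !mxE -val_eqE /= inordK//.
  by case: eqP => _; rewrite ?mulr1n ?mulr0n ?mul1r ?mul0r.
rewrite big_nat (eq_bigr _ BM) -big_nat -big_distrl /=; congr (_ * _).
rewrite -natr_sum; congr (_%:R).
have [km|km] := leqP k m.
  rewrite (bigD1_seq k) ?iota_uniq ?mem_index_iota ?k1//= eqxx big1 ?addn0//.
  by move=> j /negbTE ->.
rewrite big_nat big1// => j /andP[_ jm]; rewrite ltn_eqF//.
exact: leq_trans jm _.
Qed.

(** Cramer's rule, through the adjugate of the frame. The coefficient of row 0 drops out because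
    that row is the normal, which is orthogonal to [v] and to all other rows. *)
Lemma bary_expand B v : normal B != 0 -> height (normal B) v = 0 ->
  v = \sum_(1 <= k < d.+1)
        (bary B v k / \det (frame (normal B)^T B)) *: B k.
Proof.
move=> N0 Nv; set M := frame _ _.
have D0 : \det M != 0 by rewrite -height_normal gt_eqF// height_tr_gt0.
have vE : v = \sum_k ((v *m \adj M) ord0 k / \det M) *: row k M.
  have : (v *m \adj M) *m M = \det M *: v.
    by rewrite -mulmxA mul_adj_mx mul_mx_scalar.
  move=> /(congr1 (fun w => (\det M)^-1 *: w)); rewrite scalerA mulVf// scale1r.
  move=> vE; rewrite -[LHS]vE mulmx_sum_row scaler_sumr; apply: eq_bigr => k _.
  by rewrite scalerA mulrC.
have v0 : (v *m \adj M) ord0 ord0 = 0.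
  move: Nv; rewrite {1}vE big_ord_recl heightD heightZ rowK eqxx.
  rewrite [X in _ + X](_ : _ = 0); last first.
    rewrite /height mulmx_suml summxE big1// => k _.
    rewrite -/(height _ _) heightZ rowK eq_sym (negbTE (neq_lift _ _)).
    by rewrite normal_orth ?mulr0//= /bump leq0n add1n ltn_ord.
  rewrite addr0 height_normal -/M divfK//.
rewrite {1}vE big_ord_recl v0 mul0r scale0r add0r big_add1 big_mkord /=.
apply: eq_bigr => k _; rewrite rowK eq_sym (negbTE (neq_lift _ _)).
rewrite /bary /= ltn_ord; congr (((v *m \adj M) ord0 _ / _) *: _).
by apply: val_inj; rewrite /= inordK// ltnS ltn_ord.
Qed.

(** Summation by parts: it converts coordinates along the edges into weights on the vertices. *)
Lemma abel_sum (b : nat -> R) (y : nat -> 'rV[R]_d.+1) m :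
  \sum_(0 <= k < m.+1) (b k - b k.+1) *: y k =
  b 0%N *: y 0%N + \sum_(1 <= k < m.+1) b k *: (y k - y k.-1) - b m.+1 *: y m.
Proof.
elim: m => [|m IH]; first by rewrite big_nat1 big_nil addr0 scalerBl.
rewrite big_nat_recr//= IH [in RHS]big_nat_recr//= scalerBl scalerBr !addrA.
rewrite -!addrA; congr (_ + (_ + _)).
by rewrite addrCA; congr (_ + _); rewrite addrC.
Qed.

End simplex.

Section facet.
Context {R : realType} {d : nat}.
Variables (n : nat) (S : nat -> 'rV[R]_d.+1) (J : nat -> nat).

Definition edge k : 'rV[R]_d.+1 := S (J k.+1) - S (J k).

(* Equivalent to being a face for every configuration of points, degenerate or
   not: [P] need not be complete, so a characterization valid only off a null
   set would not make the face event measurable. *)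
Definition facet : Prop :=
  [/\ normal edge != 0,
      (forall p, (p <= n)%N -> 0 <= height (normal edge) (S p - S (J 1%N))) \/
      (forall p, (p <= n)%N -> height (normal edge) (S p - S (J 1%N)) <= 0) &
      forall p, (p <= n)%N -> height (normal edge) (S p - S (J 1%N)) = 0 ->
        in_simplex edge (S p - S (J 1%N))].

Let vertices := [set S (J k) | k in [set k | (1 <= k <= d.+1)%N]].

Lemma sum_edge m : \sum_(1 <= j < m.+1) edge j = S (J m.+1) - S (J 1%N).
Proof. by rewrite telescope_sumr. Qed.

Lemma in_simplexP x : normal edge != 0 ->
  height (normal edge) (x - S (J 1%N)) = 0 ->
  in_simplex edge (x - S (J 1%N)) <-> conv_hull vertices x.
Proof.
move=> N0 Nx; set D := \det (frame (normal edge)^T edge).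
have D0 : 0 < D by rewrite /D -height_normal height_tr_gt0.
split=> [ix|]; last first.
  apply: (conv_hull_min (C := [set x | in_simplex edge (x - S (J 1%N))])).
    move=> {Nx} {}x y t ix iy /andP[t0 t1] k kd.
    have -> : t *: x + (1 - t) *: y - S (J 1%N) =
        t *: (x - S (J 1%N)) + (1 - t) *: (y - S (J 1%N)).
      rewrite !scalerBr addrACA; congr (_ + _).
      by rewrite -opprD -scalerDl addrC subrK scale1r.
    rewrite !bary_conv lerD// ler_wpM2l//; [exact: ix|by rewrite subr_ge0|exact: iy].
  move=> _ [k /= /andP[k1 kd] <-] j jd.
  case: k k1 kd => // m _ md; rewrite -sum_edge.
  have b1 : forall i, bary edge (\sum_(1 <= j < m.+1) edge j) i = (i <= m)%N%:R * D.
    move=> i; have [->|i0] := eqVneq i 0%N; first by rewrite /bary /= mul1r.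
    have [id|di] := leqP i d; first by rewrite sum_bary// id lt0n i0.
    rewrite /bary (negbTE i0) leqNgt di /= leqNgt (leq_trans _ di)// ?mul0r//.
  rewrite !b1 ler_pM2r// ler_nat; case: (ltnP j m) => //= jm.
  by rewrite (ltnW jm).
pose b k := bary edge (x - S (J 1%N)) k / D.
have b0 : b 0%N = 1 by rewrite /b /bary /= divff// gt_eqF.
have bd : b d.+1 = 0 by rewrite /b /bary /= ltnn mul0r.
(* Consecutive differences of the normalised edge coordinates are the vertex weights; they telescope
   to [b 0 - b d.+1 = 1]. *)
have -> : x = \sum_(k < d.+1) (b k - b k.+1) *: S (J k.+1).
  rewrite -(big_mkord xpredT (fun k => (b k - b k.+1) *: S (J k.+1))).
  rewrite (abel_sum b (fun k => S (J k.+1))) b0 bd scale0r subr0 scale1r.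
  apply/eqP; rewrite addrC -subr_eq; apply/eqP.
  rewrite {1}(bary_expand N0 Nx); apply: eq_big_nat => k /andP[k1 _].
  by rewrite prednK.
apply: (@conv_hull_sum _ _ _ _ (fun k : 'I_d.+1 => b k - b k.+1)
  (fun k : 'I_d.+1 => S (J k.+1))).
- by move=> k; rewrite subr_ge0 /b ler_pM2r ?invr_gt0//; apply: ix; rewrite leq_ord.
- rewrite -(big_mkord xpredT (fun k => b k - b k.+1)).
  rewrite (@telescope_sumr_eq _ 0%N _ (fun k => - b k))//; last first.
    by move=> k _; rewrite opprK addrC.
  by rewrite b0 bd oppr0 add0r opprK.
- by move=> k; exists k.+1 => //=.
Qed.

End facet.

Section span.
Context {R : realType} {d : nat}.
Variable B : nat -> 'rV[R]_d.+1.

Let W : {vspace 'rV[R]_d.+1} := <<[seq B k | k <- iota 1 d]>>%VS.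

Lemma mem_span_edges k : (1 <= k <= d)%N -> B k \in W.
Proof. by move=> kd; apply: memv_span; apply: map_f; rewrite mem_iota. Qed.

Lemma span_edges_null (u : 'cV[R]_d.+1) w :
  (forall k, (1 <= k <= d)%N -> height u (B k) = 0) -> w \in W -> height u w = 0.
Proof.
move=> uB /coord_span ->; rewrite /height mulmx_suml summxE big1// => i _.
have isz : (i < d)%N by rewrite (leq_trans (ltn_ord i))// size_map size_iota.
rewrite -/(height _ _) heightZ [X in height _ X](_ : _ = B i.+1).
  by rewrite uB ?mulr0.
by rewrite (nth_map 0%N) ?size_iota// nth_iota.
Qed.

Lemma dim_span_edges : (\dim W <= d)%N.
Proof. by rewrite (leq_trans (dim_span _))// size_map size_iota. Qed.

(** A nonzero normal completes the edges to an invertible frame, so they span dimension at least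
    [d]. Conversely, if the normal were 0 every frame would be singular; with [v] outside [W], some
    [u != 0] would be orthogonal to [v] and to [W], hence to the whole space and to itself. *)
Lemma dim_span_normal : \dim W = d <-> normal B != 0.
Proof.
have dimT : \dim {:'rV[R]_d.+1} = d.+1 by rewrite dimvf /dim /= mul1n.
split=> [dW|N0]; last first.
  apply/eqP; rewrite eqn_leq dim_span_edges /=.
  have : ({:'rV[R]_d.+1} <= <[(normal B)^T]> + W)%VS.
    apply/subvP => x _.
    have Mu : frame (normal B)^T B \in unitmx.
      by rewrite unitmxE unitfE -height_normal gt_eqF// height_tr_gt0.
    rewrite -(mulmxKV Mu x) mulmx_sum_row; apply: rpred_sum => k _.
    apply: rpredZ; rewrite rowK; case: eqP => k0.
      by apply: (subvP (addvSl _ _)); rewrite memv_line.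
    by apply: (subvP (addvSr _ _)); apply: mem_span_edges; apply: ord_neq0_range.
  move=> /dimvS; rewrite dimT => /leq_trans/(_ (dimv_add_leqif _ _).1).
  by rewrite dim_vline; case: (_ != 0) => //; rewrite add0n => /ltnW.
apply/eqP => N0.
have [v vW] : exists v, v \notin W.
  apply/not_existsP => H.
  have /dimvS : ({:'rV[R]_d.+1} <= W)%VS.
    by apply/subvP => x _; apply/negPn/negP; exact: H.
  by rewrite dimT dW ltnn.
have /det0_null[u u0 uM] : \det (frame v B) = 0.
  by rewrite -height_normal N0 /height mulmx0 mxE.
have uv : height u v = 0 by have := uM ord0; rewrite rowK eqxx.
have uB k : (1 <= k <= d)%N -> height u (B k) = 0.
  move=> /andP[k1 kd]; have kd' : (k < d.+1)%N by [].
  have := uM (Ordinal kd'); rewrite rowK; case: eqP => // /(congr1 val)/= k0.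
  by rewrite k0 in k1.
have full : u^T \in (<[v]> + W)%VS.
  have : ({:'rV[R]_d.+1} <= <[v]> + W)%VS.
    rewrite -(geq_leqif (dimv_leqif_sup (subvf _))) dimT.
    rewrite dimv_disjoint_sum.
      rewrite dW dim_vline; case: eqP => // v0.
      by rewrite v0 mem0v in vW.
    apply/eqP; rewrite -subv0; apply/subvP => x; rewrite memv_cap.
    move=> /andP[/vlineP[a ->] avW]; rewrite memv0 scaler_eq0.
    apply: contraNT vW; rewrite negb_or => /andP[a0 _].
    by rewrite -(scalerK a0 v) rpredZ.
  by move=> /subvP; apply; rewrite memvf.
have := height_tr_gt0 u0; case/memv_addP: full => _ /vlineP[a ->] [w wW ->].
by rewrite heightD heightZ uv mulr0 add0r (span_edges_null uB wW) ltxx.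
Qed.

End span.

Section facetP.
Context {R : realType} {d : nat}.
Variables (n : nat) (S : nat -> 'rV[R]_d.+1) (J : nat -> nat).

Let points := [set S k | k in [set k | (k <= n)%N]].
Let vertices := [set S (J k) | k in [set k | (1 <= k <= d.+1)%N]].

Lemma has_dim_facet : has_dim (conv_hull vertices) d <-> normal (edge S J) != 0.
Proof.
pose B := edge S J; pose W := <<[seq B k | k <- iota 1 d]>>%VS.
have vx k : (1 <= k <= d.+1)%N -> conv_hull vertices (S (J k)).
  by move=> kd; apply: sub_conv_hull; exists k.
have inW x : conv_hull vertices x -> x - S (J 1%N) \in W.
  apply: (conv_hull_min (C := [set x | x - S (J 1%N) \in W])).
    move=> {}x y t /= xW yW _.
    have -> : t *: x + (1 - t) *: y - S (J 1%N) =
        t *: (x - S (J 1%N)) + (1 - t) *: (y - S (J 1%N)).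
      rewrite !scalerBr addrACA; congr (_ + _).
      by rewrite -opprD -scalerDl addrC subrK scale1r.
    by rewrite rpredD// rpredZ.
  move=> _ [[|m] /= md <-] //=.
  rewrite -(sum_edge S J m) big_nat rpred_sum// => k.
  by move=> /andP[k1 km]; apply: mem_span_edges; lia.
have inW2 x y : conv_hull vertices x -> conv_hull vertices y -> x - y \in W.
  move=> xV yV; have -> : x - y = (x - S (J 1%N)) - (y - S (J 1%N)).
    by rewrite opprB addrA subrK.
  by rewrite rpredB// inW.
have Wmin (V : {vspace 'rV[R]_d.+1}) : (forall x y, conv_hull vertices x ->
    conv_hull vertices y -> x - y \in V) -> (W <= V)%VS.
  move=> HV; apply/span_subvP => _ /mapP[k] /[!mem_iota] /andP[k1 kd] ->.
  by rewrite add1n ltnS in kd; apply: HV; apply: vx; lia.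
rewrite -dim_span_normal -/B -/W; split=> [[_ [V [dV V1 V2]]]|dW].
  apply/eqP; rewrite eqn_leq dim_span_edges -[leqLHS]dV.
  by apply: dimvS; apply: V2.
split; first by exists (S (J 1%N)); apply: vx.
by exists W; split.
Qed.

(** A functional that is constant on a [d]-dimensional simplex is a multiple of the normal, which
    gives the side condition. Conversely plus or minus the normal supports the hull, and its face is
    no larger than the simplex because the points [S p] on the hyperplane lie in the simplex. *)
Lemma facetP : (forall k, (1 <= k <= d.+1)%N -> (J k <= n)%N) ->
  faces d (conv_hull points) (conv_hull vertices) <-> facet n S J.
Proof.
move=> Jn; set N := normal (edge S J).
have vp : vertices `<=` points by move=> _ [k /= kd <-]; exists (J k) => //=; exact: Jn.
have vx k : (1 <= k <= d.+1)%N -> conv_hull vertices (S (J k)).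
  by move=> kd; apply: sub_conv_hull; exists k.
have vhull x : conv_hull vertices x -> height N (x - S (J 1%N)) = 0.
  suff : conv_hull vertices `<=` [set x | height N (x - S (J 1%N)) = 0] by apply.
  apply: conv_hull_min => /=.
    move=> {}x y t /eqP; rewrite heightB subr_eq0 => /eqP xN.
    move=> /eqP; rewrite heightB subr_eq0 => /eqP yN _.
    by rewrite heightB heightD !heightZ xN yN -mulrDl [t + _]addrC subrK mul1r subrr.
  move=> _ [[|m] /= md <-] //=.
  rewrite -(sum_edge S J m) big_nat /height mulmx_suml.
  rewrite summxE big1// => k /andP[k1 km].
  by rewrite -/(height _ _) normal_orth//; lia.
split=> [[[u [c [uc FE]]] /has_dim_facet N0]|[N0 side flat]].
- have uv x : conv_hull vertices x -> height u x = c by rewrite FE => -[].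
  have [a ua] : exists a, u = a *: N.
    apply: orth_normal => // k /andP[k1 kd].
    by rewrite heightB !uv ?subrr//; apply: vx; lia.
  have pc p : (p <= n)%N -> conv_hull points (S p).
    by move=> pn; apply: sub_conv_hull; exists p.
  have up p : (p <= n)%N -> a * height N (S p - S (J 1%N)) <= 0.
    move=> pn; rewrite -heightZl -ua heightB (uv (S (J 1%N))) ?subr_le0.
      by apply: uc; exact: pc.
    exact: vx.
  have flat p : (p <= n)%N -> height N (S p - S (J 1%N)) = 0 ->
      conv_hull vertices (S p).
    move=> pn Np; rewrite FE; split; first exact: pc.
    rewrite /hyperplane /= -/(height _ _) -(uv (S (J 1%N))); last exact: vx.
    by apply/eqP; rewrite -subr_eq0 -heightB ua heightZl Np mulr0.
  split=> //; last first.
    by move=> p pn Np; apply/in_simplexP => //; exact: flat.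
  have [a0|a0|a0] := ltrgtP a 0.
  + by left=> p pn; have := up p pn; rewrite nmulr_rle0.
  + by right=> p pn; have := up p pn; rewrite pmulr_rle0.
  (* Here [u = 0], so the face is the whole hull and every point has height 0 relative to the first
     vertex. *)
  + left=> p pn; rewrite vhull// FE; split; first exact: pc.
    rewrite /hyperplane /= -(uv (S (J 1%N))); last exact: vx.
    by rewrite -/(height _ _) ua a0 !heightZl !mul0r.
- split; last exact/has_dim_facet.
  suff [u [uN us]] : exists u, (forall x, height N x = 0 <-> height u x = 0) /\
      (forall p, (p <= n)%N -> height u (S p) <= height u (S (J 1%N))).
    have uN' x : height u x = height u (S (J 1%N)) <-> height N (x - S (J 1%N)) = 0.
      rewrite uN heightB; split=> [->|/eqP]; first by rewrite subrr.
      by rewrite subr_eq0 => /eqP.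
    exists u, (height u (S (J 1%N))).
    have le x : conv_hull points x -> height u x <= height u (S (J 1%N)).
      by apply: conv_hull_half => _ [p /= pn <-]; exact: us.
    split; first exact: le.
    rewrite eqEsubset; split=> x.
      move=> xv; split; last by apply/uN'; exact: vhull.
      by move: xv; apply: conv_hull_min; [exact: conv_hull_convex|
        move=> y /vp; exact: sub_conv_hull].
    (* This stronger condition is convex and so passes from the points to their hull: an inner point
       of a segment is at the maximal height only if both ends are. *)
    move=> [xp xu]; suff : conv_hull points `<=` [set x |
        height u x <= height u (S (J 1%N)) /\
        (height u x = height u (S (J 1%N)) -> conv_hull vertices x)].
      by move=> /(_ x xp)[_]; apply.
    apply: conv_hull_min => /=; last first.
      move=> _ [p /= pn <-]; split; first exact: us.
      by move=> /uN' Np; apply/in_simplexP => //; exact: flat.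
    move=> y z t [yu yv] [zu zv] /andP[t0 t1]; rewrite heightD !heightZ.
    split; first by nra.
    move=> yz; have [tz|tn0] := eqVneq t 0.
      rewrite tz in yz *; rewrite scale0r add0r subr0 scale1r.
      by apply: zv; lra.
    have [t1'|tn1] := eqVneq t 1.
      rewrite t1' in yz *; rewrite subrr scale0r addr0 scale1r.
      by apply: yv; lra.
    have {}t0 : 0 < t by rewrite lt_neqAle eq_sym tn0.
    have {}t1 : t < 1 by rewrite lt_neqAle tn1.
    by apply: conv_hull_convex; [apply: yv; nra|apply: zv; nra|rewrite !ltW].
  case: side => side.
    exists (- N); split=> [x|p pn].
      by rewrite heightNl; split=> [->|/eqP]; rewrite ?oppr0// oppr_eq0 => /eqP.
    by have := side p pn; rewrite heightB !heightNl; lra.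
  exists N; split=> // p pn; by have := side p pn; rewrite heightB; lra.
Qed.

End facetP.

(** * Walks and rearrangements of their steps *)

Section walk.
Context {V : zmodType}.
Implicit Types (x : nat -> V) (o a c p q : nat).

Definition walk x p : V := \sum_(0 <= j < p) x j.

Lemma walk0 x : walk x 0 = 0.
Proof. by rewrite /walk big_nil. Qed.

Lemma walkS x p : walk x p.+1 = walk x p + x p.
Proof. by rewrite /walk big_nat_recr. Qed.

Lemma eq_walk x y p : (forall j, (j < p)%N -> x j = y j) -> walk x p = walk y p.
Proof. by move=> xy; apply: eq_big_nat => j /andP[_]; exact: xy. Qed.

Lemma walk_shift x y o o' q : (forall j, (j < q)%N -> y (o' + j)%N = x (o + j)%N) ->
  walk y (o' + q)%N - walk y o' = walk x (o + q)%N - walk x o.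
Proof.
elim: q => [|q IH] yx; first by rewrite !addn0 !subrr.
rewrite !addnS !walkS -!(addrAC _ (- _)) IH ?yx// => j jq.
by rewrite yx// ltnW.
Qed.

Definition rotate o a c j :=
  if (o <= j < o + a)%N then (o + (j - o + c) %% a)%N else j.

Definition mirror o a j :=
  if (o <= j < o + a)%N then (o + (a.-1 - (j - o)))%N else j.

(** Reversing and negating the steps of a window makes the walk run through its old path there
    backwards, translated to begin at the same point. *)
Definition reflect_steps o a x j :=
  if (o <= j < o + a)%N then - x (mirror o a j) else x j.

Lemma walk_rotate_low x o a c p : (p <= o)%N ->
  walk (x \o rotate o a c) p = walk x p.
Proof. by move=> po; apply: eq_walk => j jp /=; rewrite /rotate ifF//; lia. Qed.

Lemma walk_rotate1 x o a c q : (c + q <= a)%N ->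
  walk (x \o rotate o a c) (o + q)%N - walk x o =
  walk x (o + c + q)%N - walk x (o + c)%N.
Proof.
move=> qa; rewrite -[X in _ - X](walk_rotate_low x a c (leqnn o)).
apply: walk_shift => j jq /=; rewrite /rotate ifT; last by lia.
by rewrite modn_small; last lia; congr x; lia.
Qed.

Lemma walk_rotate2 x o a c q : (q <= c <= a)%N ->
  walk (x \o rotate o a c) (o + (a - c) + q)%N -
  walk (x \o rotate o a c) (o + (a - c))%N = walk x (o + q)%N - walk x o.
Proof.
move=> qa; apply: walk_shift => j jq /=; rewrite /rotate ifT; last by lia.
have -> : (o + (a - c) + j - o + c = a + j)%N by lia.
by rewrite modnDl modn_small//; lia.
Qed.

Lemma walk_rotate_high x o a c p : (c <= a)%N -> (o + a <= p)%N ->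
  walk (x \o rotate o a c) p = walk x p.
Proof.
move=> ca oap; rewrite -(subnKC oap).
suff e : walk (x \o rotate o a c) (o + a)%N = walk x (o + a)%N.
  rewrite -[LHS](subrK (walk (x \o rotate o a c) (o + a)%N)) [X in _ + X]e.
  rewrite -[RHS](subrK (walk x (o + a)%N)); congr (_ + _).
  by apply: walk_shift => j _ /=; rewrite /rotate ifF//; lia.
have := @walk_rotate2 x o a c c; have := @walk_rotate1 x o a c (a - c).
rewrite leqnn ca subnKC// leqnn -!addnA subnKC// subnK// => /(_ isT) h1 /(_ isT) h2.
apply/eqP; rewrite -(inj_eq (addIr (- walk x o))); apply/eqP.
rewrite -[LHS](subrKA (walk (x \o rotate o a c) (o + (a - c)))) h1.
rewrite [X in X + _]h2 addrC addrA.
by rewrite subrK.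
Qed.

Lemma walk_reflect_low x o a p : (p <= o)%N ->
  walk (reflect_steps o a x) p = walk x p.
Proof. by move=> po; apply: eq_walk => j jp; rewrite /reflect_steps ifF//; lia. Qed.

Lemma walk_reflect x o a q : (q <= a)%N ->
  walk (reflect_steps o a x) (o + q)%N - walk x o =
  walk x (o + (a - q))%N - walk x (o + a)%N.
Proof.
elim: q => [|q IH] qa.
  by rewrite addn0 subn0 subrr walk_reflect_low// subrr.
rewrite addnS walkS addrAC IH ?(ltnW qa)//.
rewrite /reflect_steps /mirror !ifT; [|lia..].
have -> : (o + (a.-1 - (o + q - o)) = o + (a - q.+1))%N by lia.
have -> : (o + (a - q) = (o + (a - q.+1)).+1)%N by lia.
by rewrite walkS addrAC addrK.
Qed.

Lemma walk_reflect_high x o a q :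
  walk (reflect_steps o a x) (o + a + q)%N -
  walk (reflect_steps o a x) (o + a)%N = walk x (o + a + q)%N - walk x (o + a)%N.
Proof. by apply: walk_shift => j _; rewrite /reflect_steps ifF//; lia. Qed.

(** Permutations of the first [n] indices, kept as functions on [nat] so that window arithmetic
    needs no ordinals; the values from [n] on are free. *)
Definition permutes n (f : nat -> nat) :=
  (forall j, (j < n)%N -> (f j < n)%N) /\
  (forall j k, (j < n)%N -> (k < n)%N -> f j = f k -> j = k).

Lemma permutes_comp n f g : permutes n f -> permutes n g -> permutes n (f \o g).
Proof.
move=> [fn fi] [gn gi]; split=> [j jn|j k jn kn /= e]; first exact/fn/gn.
by apply: gi => //; apply: fi => //; exact: gn.
Qed.

Lemma permutes_rotate n o a c : (o + a <= n)%N -> permutes n (rotate o a c).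
Proof.
move=> oan; split=> [j jn|j k jn kn].
  rewrite /rotate; case: ifP => // /andP[oj jo].
  by apply: leq_trans oan; rewrite ltn_add2l ltn_mod; lia.
rewrite /rotate; case: ifP => [/andP[oj jo]|oj]; case: ifP => [/andP[ok ko]|ok].
- move=> /addnI/eqP; rewrite eqn_modDr !modn_small; [|lia..].
  by move=> /eqP; lia.
- have : ((j - o + c) %% a < a)%N by rewrite ltn_mod; lia.
  by move=> + e; move: ok; rewrite -e; lia.
- have : ((k - o + c) %% a < a)%N by rewrite ltn_mod; lia.
  by move=> + e; move: oj; rewrite e; lia.
- by [].
Qed.

Lemma permutes_mirror n o a : (o + a <= n)%N -> permutes n (mirror o a).
Proof.
move=> oan; split=> [j jn|j k jn kn]; rewrite /mirror.
  by case: ifP => //; lia.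
by case: ifP; case: ifP; lia.
Qed.

End walk.

(** * General position for all rearrangements of the steps *)

Section generic.
Context {R : realType} {d : nat}.
Implicit Types (x : nat -> 'rV[R]_d.+1) (J : nat -> nat).

(** One order constrains only the sums of initial segments. Asking for all orders lets any stretch
    of steps come first, and makes the condition stable under the rearrangements used later. *)
Definition generic n x :=
  forall f, permutes n f -> general_position n (walk (x \o f)).

Definition chain n J :=
  (forall k, (1 <= k < d.+1)%N -> (J k < J k.+1)%N) /\ (J d.+1 <= n)%N.

Definition vertex J p := exists2 k, (1 <= k <= d.+1)%N & J k = p.

Lemma generic_comp n x f : permutes n f -> generic n x -> generic n (x \o f).
Proof.
by move=> nf gx g ng; apply: (gx (f \o g)); exact: permutes_comp.
Qed.

Lemma chain_le n J k l : chain n J -> (1 <= k <= l)%N -> (l <= d.+1)%N ->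
  (J k <= J l)%N.
Proof.
move=> [Jlt _] /andP[k1]; elim: l => [|l IH]; first by rewrite leqNgt k1.
rewrite leq_eqVlt => /predU1P[->//|]; rewrite ltnS => kl ld.
by rewrite (leq_trans (IH kl (ltnW ld)))// ltnW// Jlt// ld (leq_trans k1).
Qed.

Lemma chain_lt n J k l : chain n J -> (1 <= k < l)%N -> (l <= d.+1)%N ->
  (J k < J l)%N.
Proof.
move=> cJ /andP[k1 kl] ld; have [Jlt _] := cJ.
by rewrite (leq_trans (Jlt k _)) ?(chain_le cJ)//; lia.
Qed.

Lemma chain_inj n J k l : chain n J -> (1 <= k <= d.+1)%N -> (1 <= l <= d.+1)%N ->
  J k = J l -> k = l.
Proof.
move=> cJ kd ld Jkl; have [kl|kl|//] := ltngtP k l.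
- by have := @chain_lt n J k l cJ; rewrite Jkl ltnn; lia.
- by have := @chain_lt n J l k cJ; rewrite Jkl ltnn; lia.
Qed.

Lemma chain_leq n J k : chain n J -> (1 <= k <= d.+1)%N -> (J k <= n)%N.
Proof.
move=> cJ kd; apply: leq_trans cJ.2; apply: (chain_le cJ) => //; lia.
Qed.

(** A cyclic shift by [p0] moves [walk x p0] to the origin, and the differences become [d.+1]
    distinct partial sums of the shifted walk, hence a basis. *)
Lemma generic_point n x p0 (p : 'I_d.+1 -> nat) (u : 'cV[R]_d.+1) :
  generic n x -> (forall k, (p0 < p k <= n)%N) -> injective p ->
  (forall k, height u (walk x (p k) - walk x p0) = 0) -> u = 0.
Proof.
move=> gx pn pinj up.
have p0n : (p0 <= n)%N by have := pn ord0; lia.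
have Jn (k : 'I_d.+1) : ((p k - p0).-1 < n)%N by have := pn k; lia.
have /gx/(_ (fun k => Ordinal (Jn k))) : permutes n (rotate 0 n p0).
  by apply: permutes_rotate; rewrite add0n.
move=> /(_ _)/wrap[].
  move=> k l /(congr1 val) /= kl; apply: pinj.
  by have := pn k; have := pn l; lia.
rewrite row_free_unit unitmxE unitfE => /det_neq0_null; apply => k.
rewrite rowK /= prednK; last by have := pn k; lia.
have -> : walk (x \o rotate 0 n p0) (p k - p0) = walk x (p k) - walk x p0.
  have := @walk_rotate1 _ x 0 n p0 (p k - p0); rewrite walk0 subr0 !add0n => ->.
    by rewrite subnKC//; have := pn k; lia.
  by have := pn k; lia.
exact: up.
Qed.

(** Otherwise the vertices and the point [p] would be [d.+2] points of the walk on one affine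
    hyperplane. *)
Lemma generic_height n x J p : chain n J -> generic n x ->
  (p <= n)%N -> ~ vertex J p ->
  height (normal (edge (walk x) J)) (walk x p - walk x (J 1%N)) <> 0.
Proof.
move=> cJ gx pn Jp; rewrite height_normal => /det0_null[u u0 uM].
have up : height u (walk x p - walk x (J 1%N)) = 0.
  by have := uM ord0; rewrite rowK eqxx.
have ue k : (1 <= k < d.+1)%N -> height u (edge (walk x) J k) = 0.
  move=> /andP[k1 kd].
  have := uM (Ordinal kd); rewrite rowK; case: eqP => // /(congr1 val)/= k0.
  by rewrite k0 in k1.
have uJ k : (k <= d)%N -> height u (walk x (J k.+1)) = height u (walk x (J 1%N)).
  move=> kd; apply/eqP; rewrite -subr_eq0 -heightB -(sum_edge (walk x) J k).
  rewrite /height mulmx_suml summxE big_nat big1// => j /andP[j1 jk].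
  by rewrite -/(height _ _) ue//; lia.
move/eqP: up; rewrite heightB subr_eq0 => /eqP up.
have Jneq k : (1 <= k <= d.+1)%N -> J k <> p by move=> kd Jk; apply: Jp; exists k.
(* The base point has to be the earliest of these points, so it is either [p] or the first
   vertex. *)
move/eqP: u0; apply; have [pJ|pJ] := ltnP p (J 1%N).
  apply: (@generic_point n x p (fun k : 'I_d.+1 => J k.+1)) => //.
  - move=> k; rewrite (chain_leq cJ) ?ltn_ord// andbT.
    by apply: leq_trans pJ _; apply: (chain_le cJ).
  - move=> k l /(chain_inj cJ) e; apply: val_inj; apply: succn_inj.
    by apply: e; rewrite /= ltn_ord.
  - by move=> k; rewrite heightB uJ ?leq_ord// up subrr.
apply: (@generic_point n x (J 1%N)
  (fun k : 'I_d.+1 => if k == ord0 then p else J k.+1)) => //.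
- move=> k; case: eqP => k0.
    rewrite pn andbT ltn_neqAle pJ andbT; apply/eqP; exact: Jneq.
  have := ord_neq0_range k0 => kd.
  by apply/andP; split; [apply: (chain_lt cJ)|apply: (chain_leq cJ)]; lia.
- move=> k l; case: eqP => [->|k0]; case: eqP => [->|l0]//.
  + by move=> e; have := Jneq l.+1 (ltn_ord l); rewrite e.
  + by move=> e; have := Jneq k.+1 (ltn_ord k); rewrite e.
  + move=> /(chain_inj cJ) e; apply: val_inj; apply: succn_inj.
    by apply: e; rewrite /= ltn_ord.
- move=> k; case: eqP => k0; first by rewrite heightB up subrr.
  by rewrite heightB uJ ?leq_ord// subrr.
Qed.

Lemma exists_nonvertex n J : (d.+1 <= n)%N -> exists2 p, (p <= n)%N & ~ vertex J p.
Proof.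
move=> dn; apply/not_exists2P => H.
have : {subset iota 0 n.+1 <= [seq J k | k <- iota 1 d.+1]}.
  move=> p; rewrite mem_iota /= add0n ltnS => pn.
  have [//|/contrapT[k kd <-]] := H p.
  by apply: (map_f J (s := iota 1 d.+1)); rewrite mem_iota; lia.
by move=> /(uniq_leq_size (iota_uniq _ _)); rewrite size_map !size_iota; lia.
Qed.

Lemma height_vertex x J k : (1 <= k <= d.+1)%N ->
  height (normal (edge (walk x) J)) (walk x (J k)) =
  height (normal (edge (walk x) J)) (walk x (J 1%N)).
Proof.
case: k => // m md; apply/eqP; rewrite -subr_eq0 -heightB -(sum_edge (walk x) J m).
rewrite /height mulmx_suml summxE big_nat big1// => j /andP[j1 jk].
by rewrite -/(height _ _) normal_orth//; lia.
Qed.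

(* The permuted walk [x \o f] turns the increment of [x] between [p] and [q]
   into the displacement between a vertex and a point that is not one. *)
Lemma generic_height_perm n x f J p q p' k : chain n J -> generic n x ->
  permutes n f -> (forall k, (1 <= k <= d.+1)%N -> walk (x \o f) (J k) = walk x (J k)) ->
  (1 <= k <= d.+1)%N -> (p' <= n)%N -> ~ vertex J p' ->
  walk (x \o f) p' - walk (x \o f) (J k) = walk x q - walk x p \/
  walk (x \o f) (J k) - walk (x \o f) p' = walk x q - walk x p ->
  height (normal (edge (walk x) J)) (walk x p) <>
  height (normal (edge (walk x) J)) (walk x q).
Proof.
move=> cJ gx nf fJ kd p'n Jp' D.
have := @generic_height n (x \o f) J p' cJ (generic_comp nf gx) p'n Jp'.
have E : normal (edge (walk (x \o f)) J) = normal (edge (walk x) J).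
  by apply: eq_normal => l ld; rewrite /edge !fJ//; lia.
rewrite heightB -(height_vertex _ _ kd) -heightB E => h pq; apply: h; case: D.
  by move=> ->; rewrite heightB pq subrr.
rewrite -[X in height _ X]opprB => ->.
by rewrite heightN heightB pq subrr oppr0.
Qed.

Lemma rotate_vertices x J o a c : (c <= a)%N ->
  (forall k, (1 <= k <= d.+1)%N -> (J k <= o)%N \/ (o + a <= J k)%N) ->
  forall k, (1 <= k <= d.+1)%N -> walk (x \o rotate o a c) (J k) = walk x (J k).
Proof.
move=> ca Jw k /Jw[Jo|Jo]; first exact: walk_rotate_low.
exact: walk_rotate_high.
Qed.

End generic.

(** * Measurability *)

Section measurable_rV.
Context {R : realType} {dT : measure_display} {T : measurableType dT}.

Lemma measurable_coord d (j : 'I_d) :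
  measurable_fun setT (fun v : 'rV[R]_d => v ord0 j).
Proof.
move=> _ Y mY; rewrite setTI; apply: sub_sigma_algebra => /=.
rewrite -bigcup_seq/=; exists j => /=; first by rewrite mem_index_enum.
by exists Y => //; rewrite setTI.
Qed.

Lemma measurable_rVP d (f : T -> 'rV[R]_d) :
  measurable_fun setT f <-> forall j, measurable_fun setT (fun x => f x ord0 j).
Proof.
split=> [mf j|mf]; first exact: (measurableT_comp (measurable_coord j)).
move=> _ A mA; rewrite setTI.
have : preimage_set_system setT f (g_sigma_preimage (fun j (v : 'rV[R]_d) => v ord0 j))
    (f @^-1` A) by exists A => //; rewrite setTI.
rewrite -g_sigma_preimage_comp; apply: smallest_sub.
  exact: sigma_algebra_measurable.
rewrite -bigcup_seq => B [j _ [Y mY <-]].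
by apply: mf.
Qed.

Lemma measurable_rVD d (f g : T -> 'rV[R]_d) :
  measurable_fun setT f -> measurable_fun setT g ->
  measurable_fun setT (fun x => f x + g x).
Proof.
move=> /measurable_rVP mf /measurable_rVP mg; apply/measurable_rVP => j.
by under eq_fun do rewrite mxE; exact: measurable_funD.
Qed.

Lemma measurable_rVN d (f : T -> 'rV[R]_d) :
  measurable_fun setT f -> measurable_fun setT (fun x => - f x).
Proof.
move=> /measurable_rVP mf; apply/measurable_rVP => j.
by under eq_fun do rewrite mxE; exact: measurableT_comp.
Qed.

Lemma measurable_rVB d (f g : T -> 'rV[R]_d) :
  measurable_fun setT f -> measurable_fun setT g ->
  measurable_fun setT (fun x => f x - g x).
Proof. by move=> mf mg; apply: measurable_rVD => //; exact: measurable_rVN. Qed.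

Lemma measurable_walk d (f : nat -> T -> 'rV[R]_d) p :
  (forall k, (k < p)%N -> measurable_fun setT (f k)) ->
  measurable_fun setT (fun x => walk (f ^~ x) p).
Proof.
elim: p => [|p IH] mf.
  by under eq_fun do rewrite walk0; exact: measurable_cst.
under eq_fun do rewrite walkS; apply: measurable_rVD; last exact: mf.
by apply: IH => k kp; apply: mf; rewrite ltnW.
Qed.

Lemma measurable_det m (A : T -> 'M[R]_m) :
  (forall i j, measurable_fun setT (fun x => A x i j)) ->
  measurable_fun setT (fun x => \det (A x)).
Proof.
move=> mA; rewrite /determinant; apply: measurable_sum => s.
by apply: measurable_funM => //; exact: measurable_prod.
Qed.

Lemma measurable_cofactor m (A : T -> 'M[R]_m) i j :
  (forall i j, measurable_fun setT (fun x => A x i j)) ->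
  measurable_fun setT (fun x => cofactor (A x) i j).
Proof.
move=> mA; apply: measurable_funM => //; apply: measurable_det => k l.
by under eq_fun do rewrite !mxE; exact: mA.
Qed.

Lemma measurable_mulmx m p q (A : T -> 'M[R]_(m, p)) (B : T -> 'M[R]_(p, q)) i j :
  (forall i j, measurable_fun setT (fun x => A x i j)) ->
  (forall i j, measurable_fun setT (fun x => B x i j)) ->
  measurable_fun setT (fun x => (A x *m B x) i j).
Proof.
move=> mA mB; under eq_fun do rewrite mxE.
by apply: measurable_sum => k; exact: measurable_funM.
Qed.

Lemma measurable_height d (u : T -> 'cV[R]_d) (v : T -> 'rV[R]_d) :
  (forall i, measurable_fun setT (fun x => u x i ord0)) -> measurable_fun setT v ->
  measurable_fun setT (fun x => height (u x) (v x)).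
Proof.
move=> mu /measurable_rVP mv; apply: measurable_mulmx => i j.
  by rewrite (ord1 i); exact: mv.
by rewrite (ord1 j); exact: mu.
Qed.

Section frames.
Context {d : nat}.

Lemma measurable_frame (v : T -> 'rV[R]_d.+1) (B : nat -> T -> 'rV[R]_d.+1) :
  measurable_fun setT v ->
  (forall k, (1 <= k <= d)%N -> measurable_fun setT (B k)) ->
  forall i j, measurable_fun setT (fun x => frame (v x) (B ^~ x) i j).
Proof.
move=> /measurable_rVP mv mB i j.
under eq_fun do rewrite mxE; case: eqP => [_|i0]; first exact: mv.
by have /measurable_rVP := mB _ (ord_neq0_range i0); exact.
Qed.

Lemma measurable_normal (B : nat -> T -> 'rV[R]_d.+1) :
  (forall k, (1 <= k <= d)%N -> measurable_fun setT (B k)) ->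
  forall i, measurable_fun setT (fun x => normal (B ^~ x) i ord0).
Proof.
move=> mB i; under eq_fun do rewrite mxE.
by apply: measurable_cofactor; apply: measurable_frame => //; exact: measurable_cst.
Qed.

Lemma measurable_bary (B : nat -> T -> 'rV[R]_d.+1) v k :
  (forall k, (1 <= k <= d)%N -> measurable_fun setT (B k)) ->
  measurable_fun setT v -> measurable_fun setT (fun x => bary (B ^~ x) (v x) k).
Proof.
move=> mB mv.
have mF : forall i j, measurable_fun setT
    (fun x => frame (normal (B ^~ x))^T (B ^~ x) i j).
  apply: measurable_frame => //; apply/measurable_rVP => j.
  by under eq_fun do rewrite mxE; exact: measurable_normal.
rewrite /bary; case: (k == 0%N); first exact: measurable_det.
case: (k <= d)%N; last exact: measurable_cst.
apply: measurable_mulmx => i j; first by rewrite (ord1 i); have /measurable_rVP := mv; exact.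
by under eq_fun do rewrite mxE; exact: measurable_cofactor.
Qed.

Lemma measurable_forall_le m (A : nat -> set T) :
  (forall p, (p <= m)%N -> measurable (A p)) ->
  measurable [set x | forall p, (p <= m)%N -> A p x].
Proof.
move=> mA; rewrite [X in measurable X](_ : _ =
    \bigcap_(p in [set p | (p <= m)%N]) A p) //.
apply: bigcap_measurable => [|p pm]; first by exists 0%N.
exact: mA.
Qed.

Lemma measurable_ler (f g : T -> R) : measurable_fun setT f ->
  measurable_fun setT g -> measurable [set x | f x <= g x].
Proof.
move=> mf mg; have := measurable_fun_ler mf mg measurableT (Logic.I : measurable [set true]).
by rewrite setTI; congr measurable; apply/seteqP; split=> x /=.
Qed.

Lemma measurable_ltr (f g : T -> R) : measurable_fun setT f ->
  measurable_fun setT g -> measurable [set x | f x < g x].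
Proof.
move=> mf mg; have := measurable_fun_ltr mf mg measurableT (Logic.I : measurable [set true]).
by rewrite setTI; congr measurable; apply/seteqP; split=> x /=.
Qed.

Lemma measurable_eqr (f g : T -> R) : measurable_fun setT f ->
  measurable_fun setT g -> measurable [set x | f x = g x].
Proof.
move=> mf mg; rewrite [X in measurable X](_ : _ =
  [set x | f x <= g x] `&` [set x | g x <= f x]).
  by apply: measurableI; exact: measurable_ler.
apply/seteqP; split=> x /=; first by move=> ->.
by move=> [h1 h2]; apply/eqP; rewrite eq_le h1.
Qed.

Lemma measurable_facet n (S : nat -> T -> 'rV[R]_d.+1) J :
  (forall k, (k <= n)%N -> measurable_fun setT (S k)) ->
  (forall k, (1 <= k <= d.+1)%N -> (J k <= n)%N) ->
  measurable [set x | facet n (S ^~ x) J].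
Proof.
move=> mS Jn.
have mE k : (1 <= k <= d)%N -> measurable_fun setT (fun x => edge (S ^~ x) J k).
  by move=> kd; apply: measurable_rVB; apply: mS; apply: Jn; lia.
have mp p : (p <= n)%N -> measurable_fun setT (fun x => S p x - S (J 1%N) x).
  by move=> pn; apply: measurable_rVB; apply: mS => //; apply: Jn.
have mN := measurable_normal mE.
have mh p : (p <= n)%N -> measurable_fun setT
    (fun x => height (normal (edge (S ^~ x) J)) (S p x - S (J 1%N) x)).
  by move=> pn; apply: measurable_height => //; exact: mp.
have mC0 : measurable_fun setT (fun _ : T => 0 : R) by exact: measurable_cst.
rewrite [X in measurable X](_ : _ =
  [set x | normal (edge (S ^~ x) J) != 0] `&`
  ([set x | forall p, (p <= n)%N ->
     0 <= height (normal (edge (S ^~ x) J)) (S p x - S (J 1%N) x)] `|`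
   [set x | forall p, (p <= n)%N ->
     height (normal (edge (S ^~ x) J)) (S p x - S (J 1%N) x) <= 0]) `&`
  [set x | forall p, (p <= n)%N ->
     height (normal (edge (S ^~ x) J)) (S p x - S (J 1%N) x) = 0 ->
     in_simplex (edge (S ^~ x) J) (S p x - S (J 1%N) x)]); last first.
  by apply/seteqP; split=> x /= [] // []; split.
apply: measurableI; first apply: measurableI.
- rewrite [X in measurable X](_ : _ = ~` [set x | forall p, (p <= d)%N ->
    normal (edge (S ^~ x) J) (inord p) ord0 = 0]).
    apply: measurableC; apply: measurable_forall_le => p _.
    by apply: measurable_eqr => //; exact: mN.
  apply/seteqP; split=> x /=.
    move=> /eqP N0 H; apply: N0; apply/colP => i; rewrite [RHS]mxE.
    by have := H i (leq_ord i); rewrite inord_val.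
  by move=> H; apply/eqP => N0; apply: H => p _; rewrite N0 mxE.
- apply: measurableU; apply: measurable_forall_le => p pn;
    by apply: measurable_ler => //; exact: mh.
- apply: measurable_forall_le => p pn.
  rewrite [X in measurable X](_ : _ = ~` [set x |
      height (normal (edge (S ^~ x) J)) (S p x - S (J 1%N) x) = 0] `|`
    [set x | in_simplex (edge (S ^~ x) J) (S p x - S (J 1%N) x)]); last first.
    by apply/seteqP; split=> x /=; rewrite -implyE.
  apply: measurableU.
    by apply: measurableC; apply: measurable_eqr => //; exact: mh.
  apply: measurable_forall_le => k _.
  by apply: measurable_ler; apply: measurable_bary => //; exact: mp.
Qed.

End frames.

End measurable_rV.

(** * Excursions and positions of the minimum *)

Section partition.
Context {R : realType} {dC : measure_display} {C : measurableType dC}.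
Variables (mu : probability C R) (G : set C).
Hypotheses (mG : measurable G) (muG : mu (~` G) = 0%E).

Definition pr (A : set C) : R := fine (mu A).

Lemma prE A : measurable A -> mu A = (pr A)%:E.
Proof. by move=> mA; rewrite fineK// fin_num_measure. Qed.

Lemma pr_setT : pr setT = 1.
Proof. by rewrite /pr probability_setT. Qed.

Lemma pr_setIfull A : measurable A -> pr (A `&` G) = pr A.
Proof.
move=> mA; rewrite /pr -[in RHS](setIT A) -(setUv G) setIUr measureU//.
- rewrite [X in (_ + X)%E](_ : _ = 0%E) ?adde0//.
  apply/eqP; rewrite eq_le measure_ge0 andbT -muG.
  by apply: le_measure; rewrite ?inE//; [apply: measurableI|..]; rewrite ?inE//;
    apply: measurableC.
- exact: measurableI.
- by apply: measurableI => //; exact: measurableC.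
- by rewrite setIACA setICr setI0.
Qed.

(** The sets need to partition [D] only inside [G]: ties between levels, which would spoil the
    uniqueness of a minimum, are confined to the complement. *)
Lemma pr_partition m (A : nat -> set C) (D : set C) : measurable D ->
  (forall c, (c < m)%N -> measurable (A c)) ->
  (forall x, D x -> G x -> exists2 c, (c < m)%N & A c x) ->
  (forall x c c', D x -> G x -> (c < m)%N -> (c' < m)%N -> A c x -> A c' x -> c = c') ->
  pr D = \sum_(0 <= c < m) pr (D `&` A c).
Proof.
move=> mD mA DA Auniq.
rewrite -(pr_setIfull mD) big_nat.
under eq_bigr => c cm do
  rewrite -(pr_setIfull (measurableI _ _ mD (mA c cm))).
rewrite -big_nat /pr.
have mDA c : (c < m)%N -> measurable (D `&` A c `&` G).
  by move=> cm; apply: measurableI => //; apply: measurableI => //; exact: mA.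
have -> : D `&` G = \bigcup_(c in `I_m) (D `&` A c `&` G).
  apply/seteqP; split=> x /=; last by move=> [c cm [[]]].
  by move=> [Dx Gx]; have [c cm Ac] := DA x Dx Gx; exists c.
rewrite measure_fin_bigcup//; last first.
  move=> c c' /= cm c'm [x [[[Dx Acx] Gx] [[_ Ac'x] _]]].
  exact: (Auniq x).
rewrite -fsbig_ord big_mkord sum_fine// => c _.
by rewrite fin_num_measure//; apply: mDA.
Qed.

End partition.

Section argmin.
Context {R : realType}.

Lemma exists_argmin (s : nat -> R) m : (0 < m)%N ->
  exists2 c, (c < m)%N & forall q, (q < m)%N -> s c <= s q.
Proof.
case: m => // m _; case: (@arg_minP _ _ _ (ord0 : 'I_m.+1) xpredT (fun i => s i)) => // i _ H.
by exists i => // q qm; exact: (H (Ordinal qm)).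
Qed.

(** The good starting point is the minimum, unique in the absence of ties: from any other start the
    minimum is met later on. *)
Lemma cyclic_argmin (s : nat -> R) a : (0 < a)%N ->
  (forall p q, (p < q < a)%N -> s p <> s q) ->
  exists2 c, (c < a)%N &
    forall c', (c' < a)%N ->
      (forall q, (0 < q < a)%N -> s c' < s ((c' + q) %% a)%N) <-> c' = c.
Proof.
move=> a0 sinj; have [c ca cmin] := exists_argmin s a0.
exists c => // c' c'a; split=> [H|-> q qa].
- apply/eqP/negPn/negP => c'c.
  (* The cyclic distance from [c'] to the minimum [c]; adding [a] keeps the truncated subtraction
     exact. *)
  have q_c : ((c' + (a + c - c') %% a) %% a = c)%N.
    rewrite modnDmr subnKC; last by lia.
    by rewrite modnDl modn_small.
  have := H ((a + c - c') %% a)%N; rewrite q_c ltNge cmin// ltn_mod a0 andbT.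
  rewrite lt0n; case: eqP => [q0 _|_ /(_ isT)//].
  by move: q_c; rewrite q0 addn0 modn_small// => /eqP; rewrite (negbTE c'c).
- have qa' : ((c + q) %% a < a)%N by rewrite ltn_mod.
  have cq : ((c + q) %% a <> c)%N.
    move=> e; have := divn_eq (c + q) a; rewrite e.
    by case: (_ %/ _)%N => [|[|k]]; nia.
  rewrite lt_neqAle cmin// andbT; apply/eqP => e.
  have [l|l|l] := ltngtP c ((c + q) %% a)%N.
  + by apply: (sinj c ((c + q) %% a)%N) => //; rewrite l.
  + by apply: (sinj ((c + q) %% a)%N c) => //; rewrite l.
  + exact/cq/esym.
Qed.

End argmin.

Section configurations.
Context {R : realType} {d n : nat}.
Local Notation V := 'rV[R]_d.+1.
Local Notation C := (n.-tuple V).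
Implicit Types (x : C) (u : C -> 'cV[R]_d.+1).

Definition steps x : nat -> V := fun j => nth 0 x j.

Definition relabel (f : nat -> nat) x : C := [tuple steps x (f k) | k < n].

Definition flip_window o a x : C := [tuple reflect_steps o a (steps x) k | k < n].

Lemma steps_relabel f x j : (j < n)%N -> steps (relabel f x) j = steps x (f j).
Proof.
move=> jn; rewrite /steps /relabel (nth_map (Ordinal jn)) ?size_enum_ord//.
by rewrite nth_enum_ord.
Qed.

Lemma steps_flip o a x j : (j < n)%N ->
  steps (flip_window o a x) j = reflect_steps o a (steps x) j.
Proof.
move=> jn; rewrite /steps /flip_window (nth_map (Ordinal jn)) ?size_enum_ord//.
by rewrite nth_enum_ord.
Qed.

Lemma walk_relabel f x p : (p <= n)%N ->
  walk (steps (relabel f x)) p = walk (steps x \o f) p.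
Proof. by move=> pn; apply: eq_walk => j jp; rewrite steps_relabel//; lia. Qed.

Lemma walk_flip o a x p : (p <= n)%N ->
  walk (steps (flip_window o a x)) p = walk (reflect_steps o a (steps x)) p.
Proof. by move=> pn; apply: eq_walk => j jp; rewrite steps_flip//; lia. Qed.

Lemma measurable_steps j : measurable_fun setT (fun x => steps x j).
Proof.
have [jn|nj] := ltnP j n.
  rewrite [X in measurable_fun _ X](_ : _ = @tnth n V ^~ (Ordinal jn)).
    exact: measurable_tnth.
  by apply/funext => x; rewrite (tnth_nth 0).
rewrite [X in measurable_fun _ X](_ : _ = cst 0); first exact: measurable_cst.
by apply/funext => x; rewrite /steps nth_default// size_tuple.
Qed.

Lemma measurable_walk_steps p : measurable_fun setT (fun x => walk (steps x) p).
Proof.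
by apply: (measurable_walk (f := fun j x => steps x j)) => k _; exact: measurable_steps.
Qed.

Lemma measurable_relabel f : measurable_fun setT (relabel f).
Proof.
apply/measurable_fun_tnthP => i.
rewrite [X in measurable_fun _ X](_ : _ = fun x => steps x (f i)).
  exact: measurable_steps.
by apply/funext => x /=; rewrite tnth_mktuple.
Qed.

Lemma measurable_flip o a : measurable_fun setT (flip_window o a).
Proof.
apply/measurable_fun_tnthP => i.
rewrite [X in measurable_fun _ X](_ : _ = fun x => reflect_steps o a (steps x) i).
  rewrite /reflect_steps; case: (o <= i < o + a)%N; last exact: measurable_steps.
  by apply: measurable_rVN; exact: measurable_steps.
by apply/funext => x /=; rewrite tnth_mktuple.
Qed.

Definition level u x p : R := height (u x) (walk (steps x) p).

Definition min_at u o a i : set C :=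
  [set x | forall q, (o <= q <= o + a)%N -> q <> i -> level u x i < level u x q].

Definition excursion u o a : set C :=
  [set x | forall q, (o < q < o + a)%N -> level u x o < level u x q].

Definition measurable_dir u := forall i, measurable_fun setT (fun x => u x i ord0).

Lemma measurable_level u p : measurable_dir u -> measurable_fun setT (level u ^~ p).
Proof.
by move=> mu; apply: measurable_height => //; exact: measurable_walk_steps.
Qed.

Lemma measurable_imply (b : Prop) (A : set C) : measurable A ->
  measurable [set x | b -> A x].
Proof.
move=> mA; have [hb|hb] := pselect b.
  by rewrite [X in measurable X](_ : _ = A)//; apply/seteqP; split=> x /=; [exact|].
by rewrite [X in measurable X](_ : _ = setT)//; apply/seteqP; split=> x //= _ /hb.
Qed.

Lemma measurable_forall (A : nat -> set C) :
  (forall p, measurable (A p)) -> measurable [set x | forall p, A p x].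
Proof.
move=> mA; rewrite [X in measurable X](_ : _ = \bigcap_p A p).
  exact: bigcapT_measurable.
by apply/seteqP; split=> x /= H; [move=> p _|move=> p]; exact: H.
Qed.

Lemma measurable_min_at u o a i : measurable_dir u -> measurable (min_at u o a i).
Proof.
move=> mu; apply: measurable_forall => q; apply: measurable_imply.
by apply: measurable_imply; apply: measurable_ltr; exact: measurable_level.
Qed.

Lemma measurable_excursion u o a : measurable_dir u -> measurable (excursion u o a).
Proof.
move=> mu; apply: measurable_forall => q; apply: measurable_imply.
by apply: measurable_ltr; exact: measurable_level.
Qed.

Variables (mu : probability C R) (G : set C).
Hypotheses (mG : measurable G) (muG : mu (~` G) = 0%E).

Definition invariant_under (g : C -> C) :=
  forall A, measurable A -> mu (g @^-1` A) = mu A.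

Local Notation pr := (pr mu).

Lemma pr_invariant g A : invariant_under g -> measurable A -> pr (g @^-1` A) = pr A.
Proof. by move=> gi mA; rewrite /pr gi. Qed.

(** The events that the window rotated by [c] is an excursion, for [c < a], partition [D] up to a
    null set and are equally likely within [D], because the rotations preserve the measure, [D] and
    the direction. [D] stands for what is already imposed on the rest of the walk. *)
Lemma pr_excursion u o a (D : set C) : (0 < a)%N -> (o + a <= n)%N ->
  measurable_dir u -> measurable D ->
  (forall c, (c < a)%N -> invariant_under (relabel (rotate o a c))) ->
  (forall c x, (c < a)%N -> D (relabel (rotate o a c) x) <-> D x) ->
  (forall c x, (c < a)%N -> u (relabel (rotate o a c) x) = u x) ->
  (forall x, G x -> level u x o = level u x (o + a)%N) ->
  (forall x p q, G x -> (o <= p < q)%N -> (q < o + a)%N ->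
     level u x p <> level u x q) ->
  pr (D `&` excursion u o a) = pr D / a%:R.
Proof.
move=> a0 oan mdu mD inv Drot urot closed distinct.
set E := excursion u o a.
have mE : measurable E by exact: measurable_excursion.
(* Both ends of the window have the same level, so the rotated levels are the old ones read
   cyclically, with offset [a] identified with 0. *)
have lvl c x q : (c < a)%N -> G x -> (q < a)%N ->
    level u (relabel (rotate o a c) x) (o + q)%N - level u x o =
    level u x (o + (c + q) %% a)%N - level u x (o + c)%N.
  move=> ca Gx qa; rewrite /level urot// walk_relabel; last by lia.
  rewrite -!heightB; have [cqa|acq] := leqP (c + q) a.
    rewrite walk_rotate1// !heightB -addnA; congr (_ - _).
    move: cqa; rewrite leq_eqVlt => /predU1P[->|cqa]; last by rewrite modn_small.
    by rewrite modnn addn0 -!/(level _ _ _) closed.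
  have := @walk_rotate2 _ (steps x) o a c (c + q - a).
  have -> : (o + (a - c) + (c + q - a) = o + q)%N by lia.
  move=> /(_ _)/wrap[]; first by lia.
  have := @walk_rotate1 _ (steps x) o a c (a - c).
  rewrite subnKC ?(ltnW ca)// => /(_ (leqnn a)).
  have -> : (o + c + (a - c) = o + a)%N by lia.
  move=> e1 e2; rewrite -(subrKA (walk (steps x \o rotate o a c) (o + (a - c))%N)).
  have -> : ((c + q) %% a = c + q - a)%N.
    by rewrite -{1}(subnK (ltnW acq)) modnDr modn_small//; lia.
  have := closed x Gx; rewrite e1 e2 !heightD !heightN /level => ->.
  by rewrite addrA subrK.
have rotE c x : (c < a)%N -> G x -> E (relabel (rotate o a c) x) <->
   forall q, (0 < q < a)%N -> level u x (o + c)%N < level u x (o + (c + q) %% a)%N.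
  move=> ca Gx; rewrite /E /excursion /=.
  have l0 : level u (relabel (rotate o a c) x) o = level u x o.
    by rewrite /level urot// walk_relabel ?walk_rotate_low//; lia.
  rewrite l0; split=> H q /andP[q0 qa].
    have := lvl c x q ca Gx qa.
    have /H : (o < o + q < o + a)%N by lia.
    by lra.
  have qo : (q - o < a)%N by lia.
  have /H : (0 < q - o < a)%N by rewrite qo andbT; lia.
  have := lvl c x _ ca Gx qo; rewrite subnKC ?(ltnW q0)//.
  by lra.
have cycP x : G x -> exists2 c, (c < a)%N &
    forall c', (c' < a)%N -> E (relabel (rotate o a c') x) <-> c' = c.
  move=> Gx.
  have [p q pq|c ca H] := cyclic_argmin (s := fun p => level u x (o + p)%N) a0.
    by apply: distinct => //; lia.
  by exists c => // c' c'a; rewrite (rotE c' x c'a Gx); exact: H.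
have mrE c : measurable (relabel (rotate o a c) @^-1` E).
  by rewrite -[X in measurable X]setTI; exact: measurable_relabel.
have := @pr_partition _ _ _ mu G mG muG a
  (fun c => relabel (rotate o a c) @^-1` E) D mD.
move=> /(_ _)/wrap[]; first by move=> c _; exact: mrE.
move=> /(_ _)/wrap[].
  move=> x Dx Gx; have [c ca H] := cycP x Gx; exists c => //=.
  by apply/H.
move=> /(_ _)/wrap[].
  move=> x c c' Dx Gx ca c'a /= Ec Ec'; have [c0 c0a H] := cycP x Gx.
  by move: Ec Ec' => /H => /(_ ca) -> /H => /(_ c'a) ->.
move=> ->; rewrite (eq_big_nat _ _ (F2 := fun=> pr (D `&` E))); last first.
  move=> c /andP[_ ca].
  rewrite -[RHS](pr_invariant (inv c ca)); last exact: measurableI.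
  rewrite preimage_setI; congr (pr (_ `&` _)).
  by apply/seteqP; split=> x /=; apply Drot.
rewrite sumr_const_nat subn0 -[_ *+ a]mulr_natr mulfK// pnatr_eq0.
by rewrite -lt0n.
Qed.

End configurations.

(** * The weights of the arcsine law *)

Section arcsine.
Context {R : realType}.

(** These are the numbers C(2p, p) / 4^p, the Taylor coefficients of (1 - z)^(-1/2), whose square 1
    / (1 - z) has all coefficients equal to 1. *)
Definition arcsine (p : nat) : R := (dfact (2 * p - 1))%:R / (dfact (2 * p))%:R.

Lemma dfactSS m : dfact m.+2 = (m.+2 * dfact m)%N.
Proof. by []. Qed.

Lemma dfact_gt0 m : (0 < dfact m)%N.
Proof.
elim/ltn_ind: m => -[|[|m]] // IH; rewrite /= -/(dfact m) muln_gt0 /=.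
by apply: IH.
Qed.

Lemma arcsine0 : arcsine 0 = 1.
Proof. by rewrite /arcsine /= divff ?oner_neq0. Qed.

Lemma arcsineS p : (2 * p.+1)%:R * arcsine p.+1 = (2 * p + 1)%:R * arcsine p.
Proof.
have -> : arcsine p.+1 =
    ((2 * p + 1) * dfact (2 * p - 1))%:R / ((2 * p.+1) * dfact (2 * p))%:R.
  rewrite /arcsine; congr (_%:R / _%:R).
    case: p => // p; rewrite (_ : 2 * p.+2 - 1 = (2 * p.+1 - 1).+2)%N; last by lia.
    by rewrite dfactSS; congr muln; lia.
  rewrite (_ : 2 * p.+1 = (2 * p).+2)%N; last by lia.
  exact: dfactSS.
have h1 : (dfact (2 * p))%:R != 0 :> R by rewrite pnatr_eq0 -lt0n dfact_gt0.
have h2 : (2 * p.+1)%:R != 0 :> R by rewrite pnatr_eq0.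
have gen (a A c B : R) : c != 0 -> B != 0 -> c * (a * A / (c * B)) = a * (A / B).
  by move=> c0 B0; field; rewrite B0.
by rewrite [_%:R in X in _ * X]natrM (natrM _ (2 * p.+1) (dfact _)) gen.
Qed.

Lemma convolution_rev (r : nat -> R) p :
  2 * \sum_(0 <= i < p.+1) i%:R * (r i * r (p - i)%N) =
  p%:R * \sum_(0 <= i < p.+1) r i * r (p - i)%N.
Proof.
rewrite mulr2n mulrDl mul1r {2}big_nat_rev /= -big_split /= mulr_sumr.
apply: eq_big_nat => i ip; rewrite add0n subSS subKn; last by lia.
rewrite [r (p - i)%N * _]mulrC -mulrDl -natrD; congr (_%:R * _); lia.
Qed.

(** Multiplying the sum for [p.+1] by [p.+1] and symmetrising gives its terms the weight [2 i],
    which the recurrence for [arcsine] turns into the weight [2 i + 1] on the sum for [p];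
    symmetrising back leaves [p + 1] times that sum. *)
Lemma arcsine_convolution p :
  \sum_(0 <= i < p.+1) arcsine i * arcsine (p - i) = 1.
Proof.
elim: p => [|p IH]; first by rewrite big_nat1 arcsine0 mulr1.
have p1 : p.+1%:R != 0 :> R by rewrite pnatr_eq0.
apply: (mulfI p1); rewrite -convolution_rev big_nat_recl// mul0r add0r.
rewrite mulr1 mulr_sumr (eq_big_nat _ _ (F2 := fun i =>
  2 * (i%:R * (arcsine i * arcsine (p - i))) + arcsine i * arcsine (p - i))).
  by rewrite big_split /= -mulr_sumr convolution_rev IH mulr1 -natr1.
move=> i ip; rewrite subSS; have := arcsineS i; rewrite !natrM natrD natrM.
move: (arcsine i.+1) (arcsine i) (arcsine (p - i)) => a1 a b a1E.
have -> : 2 * (i.+1%:R * (a1 * b)) = 2 * i.+1%:R * a1 * b by ring.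
by rewrite a1E; ring.
Qed.

End arcsine.

(** * Symmetric walks and the position of their minimum *)

Section sparre_andersen.
Context {R : realType} {d n : nat}.
Local Notation V := 'rV[R]_d.+1.
Local Notation C := (n.-tuple V).
Implicit Types (x : C) (u : C -> 'cV[R]_d.+1).
Variables (mu : probability C R) (G : set C).
Hypotheses (mG : measurable G) (muG : mu (~` G) = 0%E).
Local Notation pr := (pr mu).
Variables (u : C -> 'cV[R]_d.+1) (lo hi : nat).
Hypotheses (lohi : (lo <= hi <= n)%N) (mdu : measurable_dir u).
Hypothesis inv : forall o a, (lo <= o)%N -> (o + a <= hi)%N ->
  invariant_under mu (flip_window o a).
Hypothesis uflip : forall o a x, (lo <= o)%N -> (o + a <= hi)%N ->
  u (flip_window o a x) = u x.
Hypothesis distinct : forall x p q, G x -> (lo <= p < q)%N -> (q <= hi)%N ->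
  level u x p <> level u x q.

(** All subwindows are included because the induction cuts the window at its minimum and reflects
    the pieces. *)
Definition flip_stable o a (D : set C) := forall o' a' x,
  (o <= o')%N -> (o' + a' <= o + a)%N -> D (flip_window o' a' x) <-> D x.

Lemma level_flip o a x q : (lo <= o)%N -> (o + a <= hi)%N -> (q <= a)%N ->
  level u (flip_window o a x) (o + q)%N - level u x o =
  level u x (o + (a - q))%N - level u x (o + a)%N.
Proof.
move=> lo_o oahi qa; rewrite /level uflip// walk_flip; last by lia.
by rewrite -!heightB walk_reflect.
Qed.

Lemma level_flip_low o a x q : (lo <= o)%N -> (o + a <= hi)%N -> (q <= o)%N ->
  level u (flip_window o a x) q = level u x q.
Proof.
move=> lo_o oahi qo; rewrite /level uflip// walk_flip; last by lia.
by rewrite walk_reflect_low.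
Qed.

(** Reflecting the window exchanges the roles of its two ends and preserves both the measure and
    [D]. *)
Lemma pr_min_at_end o a (D : set C) : (lo <= o)%N -> (o + a <= hi)%N ->
  measurable D -> flip_stable o a D ->
  pr (D `&` min_at u o a (o + a)%N) = pr (D `&` min_at u o a o).
Proof.
move=> lo_o oahi mD stable.
rewrite -(pr_invariant (inv lo_o oahi)); last first.
  by apply: measurableI => //; exact: measurable_min_at.
rewrite preimage_setI; congr (pr (_ `&` _)).
  apply/seteqP; split=> x /=; have [h1 h2] := stable o a x (leqnn o) (leqnn _);
    by [apply: h1|apply: h2].
have lvl x q := @level_flip o a x q lo_o oahi.
apply/seteqP; split=> x /= H q qoa qo.
- have := H (o + (a - (q - o)))%N; have := lvl x a; have := lvl x (a - (q - o))%N.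
  rewrite subnn addn0 leqnn subKn; last by lia.
  rewrite subnKC; last by lia.
  move=> /(_ _)/wrap[]; first by lia.
  move=> h1 /(_ isT) h2 /(_ _)/wrap[]; first by lia.
  by move=> /(_ _)/wrap[]; [lia|lra].
- have := H (o + (a - (q - o)))%N; have := lvl x a; have := lvl x (q - o)%N.
  rewrite subnn addn0 leqnn subnKC; last by lia.
  move=> /(_ _)/wrap[]; first by lia.
  move=> h1 /(_ isT) h2 /(_ _)/wrap[]; first by lia.
  by move=> /(_ _)/wrap[]; [lia|lra].
Qed.

Lemma exists_min_at x o a : G x -> (lo <= o)%N -> (o + a <= hi)%N ->
  exists2 i, (i < a.+1)%N & min_at u o a (o + i)%N x.
Proof.
move=> Gx lo_o oahi.
have [c ca cmin] := exists_argmin (fun i => level u x (o + i)%N) (ltn0Sn a).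
exists c => // q /andP[oq qoa] qc; rewrite lt_neqAle.
have := cmin (q - o)%N; rewrite subnKC// => ->; last by lia.
rewrite andbT; apply/eqP => e.
have [l|l|l] := ltngtP (o + c)%N q.
- by apply: (distinct Gx _ _ e); lia.
- by apply: (distinct Gx _ _ (esym e)); lia.
- exact/qc/esym.
Qed.

Lemma min_at_uniq x o a i j : (i < a.+1)%N -> (j < a.+1)%N ->
  min_at u o a (o + i)%N x -> min_at u o a (o + j)%N x -> i = j.
Proof.
move=> ia ja Hi Hj; apply/eqP/negPn/negP => /eqP ij.
have := Hi (o + j)%N; have := Hj (o + i)%N.
move=> /(_ _)/wrap[]; first by lia.
move=> /(_ _)/wrap[]; first by lia.
move=> h1 /(_ _)/wrap[]; first by lia.
by move=> /(_ _)/wrap[]; [lia|lra].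
Qed.

Lemma min_at_split o a i : (i <= a)%N -> min_at u o a (o + i)%N =
  min_at u o i (o + i)%N `&` min_at u (o + i)%N (a - i) (o + i)%N.
Proof.
move=> ia; apply/seteqP; split=> x /=.
  by move=> H; split=> q qi; apply: H; lia.
move=> [H1 H2] q qi; have [qoi|oiq] := leqP q (o + i)%N.
  by apply: H1; lia.
by apply: H2; lia.
Qed.

Lemma min_at0 o : min_at u o 0 o = setT.
Proof. by apply/seteqP; split=> x //= _ q qo qo'; lia. Qed.

(* Condition on the position of the minimum: it cuts the window into two
   shorter ones, and reflecting the first turns a minimum at the end into a
   minimum at the start. *)
Lemma pr_min_at_start a o (D : set C) : (lo <= o)%N -> (o + a <= hi)%N ->
  measurable D -> flip_stable o a D ->
  pr (D `&` min_at u o a o) = arcsine a * pr D.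
Proof.
elim/ltn_ind: a o D => a IH o D lo_o oahi mD stable.
have [a0|a0] := posnP a.
  by rewrite a0 min_at0 setIT arcsine0 mul1r.
have split_min i : (i <= a)%N ->
    pr (D `&` min_at u o a (o + i)%N) =
    if (i == 0%N) || (i == a) then pr (D `&` min_at u o a o)
    else arcsine i * arcsine (a - i) * pr D.
  move=> ia; have [->|i0] := eqVneq i 0%N; first by rewrite addn0.
  have [->|ina] := eqVneq i a; first by rewrite pr_min_at_end.
  (* The second window is treated first, with the condition on the first one absorbed into [D]:
     reflections beyond [o + i] do not change the levels up to there. *)
  rewrite /= min_at_split// setIA IH; [|lia|lia|lia| |]; last 2 first.
  - by apply: measurableI => //; exact: measurable_min_at.
  - move=> o' a' x oo' oa'.
    have lvl q : (q <= o + i)%N -> level u (flip_window o' a' x) q = level u x q.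
      by move=> qoi; rewrite level_flip_low//; lia.
    have [s1 s2] : D (flip_window o' a' x) <-> D x by apply: stable; lia.
    split=> -[Dx Hx]; (split; first by auto) => q qi qoi; have := Hx q qi qoi;
      by rewrite !lvl; lia.
  have st : flip_stable o i D by move=> o' a' x oo' oa'; apply: stable; lia.
  have oihi : (o + i <= hi)%N by lia.
  rewrite (pr_min_at_end lo_o oihi mD st) IH//; last by lia.
  by rewrite mulrA [X in X * _]mulrC.
have := @pr_partition _ _ _ mu G mG muG a.+1 (fun i => min_at u o a (o + i)%N) D mD.
move=> /(_ _)/wrap[]; first by move=> c _; exact: measurable_min_at.
move=> /(_ _)/wrap[]; first by move=> x _ Gx; exact: exists_min_at.
move=> /(_ _)/wrap[]; first by move=> x c c' _ _; exact: min_at_uniq.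
have := @arcsine_convolution R a.
case: a a0 oahi split_min {IH stable} => // a _ oahi split_min.
set m := pr (D `&` min_at u o a.+1 o) in split_min *.
rewrite big_nat_recl// big_nat_recr//= subn0 subnn arcsine0 mul1r mulr1 => conv.
rewrite big_nat_recl// big_nat_recr//= (split_min 0%N)// (split_min a.+1)//.
rewrite !eqxx orbT /=.
rewrite (eq_big_nat _ _ (F2 := fun i =>
  arcsine i.+1 * arcsine (a.+1 - i.+1) * pr D)); last first.
  by move=> i ia; rewrite split_min ?ifF//; lia.
rewrite -mulr_suml => prD.
(* The two extreme positions contribute [m] each and the others [1 - 2 * arcsine a.+1] times [pr D],
   which determines [m]. *)
have : 1 * pr D = pr D by rewrite mul1r.
rewrite -{1}conv {2}prD; lra.
Qed.

End sparre_andersen.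

(** * Facet probabilities *)

Section facet_events.
Context {R : realType} {d n : nat}.
Local Notation V := 'rV[R]_d.+1.
Local Notation C := (n.-tuple V).
Implicit Types (x : C) (J : nat -> nat) (b : bool).

Definition dir b J x : 'cV[R]_d.+1 := (-1) ^+ b *: normal (edge (walk (steps x)) J).

Definition generic_set : set C := [set x | generic n (steps x)].

Definition below b J : set C :=
  [set x | forall p, (p <= n)%N -> ~ vertex (d := d) J p ->
    level (dir b J) x (J 1%N) < level (dir b J) x p].

Definition blocks b J m : set C :=
  [set x | forall k, (1 <= k <= m)%N ->
    excursion (dir b J) (J k) (J k.+1 - J k) x].

Lemma level_dirE b J x p : level (dir b J) x p =
  (-1) ^+ b * height (normal (edge (walk (steps x)) J)) (walk (steps x) p).
Proof. exact: heightZl. Qed.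

Lemma measurable_dir_dir b J : measurable_dir (dir b J).
Proof.
move=> i; under eq_fun do rewrite mxE; apply: measurable_funM => //.
apply: measurable_normal => k _; apply: measurable_rVB; exact: measurable_walk_steps.
Qed.

Lemma level_vertex b J x k : (1 <= k <= d.+1)%N ->
  level (dir b J) x (J k) = level (dir b J) x (J 1%N).
Proof. by move=> kd; rewrite !level_dirE height_vertex. Qed.

Lemma level_neq b J x p q :
  height (normal (edge (walk (steps x)) J)) (walk (steps x) p) <>
  height (normal (edge (walk (steps x)) J)) (walk (steps x) q) ->
  level (dir b J) x p <> level (dir b J) x q.
Proof.
move=> h; rewrite !level_dirE; apply: contra_not h.
by apply: mulfI; rewrite signr_eq0.
Qed.

Section vertices.
Variable J : nat -> nat.
Hypothesis cJ : chain (d := d) n J.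

Let vertex_cases k l : (1 <= k <= d.+1)%N -> (1 <= l <= d)%N ->
  (J k <= J l)%N \/ (J l.+1 <= J k)%N.
Proof.
move=> kd ld; have [kl|lk] := leqP k l; [left|right]; apply: (chain_le cJ); lia.
Qed.

Lemma vertex_between k p : (1 <= k <= d)%N -> (J k < p < J k.+1)%N ->
  ~ vertex (d := d) J p.
Proof. by move=> kd pJ [l ld e]; have := vertex_cases ld kd; lia. Qed.

Lemma vertex_low p : (p < J 1%N)%N -> ~ vertex (d := d) J p.
Proof. by move=> pJ [l ld e]; have := @chain_le d n J 1 l cJ; lia. Qed.

Lemma vertex_high p : (J d.+1 < p)%N -> ~ vertex (d := d) J p.
Proof. by move=> pJ [l ld e]; have := @chain_le d n J l d.+1 cJ; lia. Qed.

(** Rotating the block by [p - J k] turns the increment from [p] to [q] into the displacement of an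
    inner point from the vertex [J k]. The excluded pair consists of the two ends, whose levels
    agree. *)
Lemma distinct_block x k p q b : generic_set x -> (1 <= k <= d)%N ->
  (J k <= p < q)%N -> (q <= J k.+1)%N -> (p, q) <> (J k, J k.+1) ->
  level (dir b J) x p <> level (dir b J) x q.
Proof.
move=> Gx kd pq qJ npq; apply: level_neq.
have Jn : (J k.+1 <= n)%N by apply: (chain_leq cJ); lia.
have win l : (1 <= l <= d.+1)%N ->
    (J l <= J k)%N \/ (J k + (J k.+1 - J k) <= J l)%N.
  by move=> ld; have := vertex_cases ld kd; lia.
have cle : (p - J k <= J k.+1 - J k)%N by lia.
have npq' : (q - p < J k.+1 - J k)%N.
  have : ~ (p = J k /\ q = J k.+1) by move=> [e1 e2]; apply: npq; rewrite e1 e2.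
  by lia.
apply: (@generic_height_perm _ _ n (steps x) (rotate (J k) (J k.+1 - J k) (p - J k))
  J p q (J k + (q - p))%N k cJ Gx) => //.
- by apply: permutes_rotate; lia.
- exact: rotate_vertices.
- by lia.
- by lia.
- by apply: (vertex_between kd); lia.
- left; rewrite [X in _ - X](rotate_vertices _ cle win); last by lia.
  by rewrite walk_rotate1; [congr (walk _ _ - walk _ _)|]; lia.
Qed.

Lemma distinct_low x p q b : generic_set x -> (p < q <= J 1%N)%N ->
  level (dir b J) x p <> level (dir b J) x q.
Proof.
move=> Gx pq; apply: level_neq.
have Jn : (J 1%N <= n)%N by apply: (chain_leq cJ).
have win l : (1 <= l <= d.+1)%N -> (J l <= 0)%N \/ (0 + J 1%N <= J l)%N.
  by move=> ld; right; apply: (chain_le cJ); lia.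
(* Rotating by [q] puts the steps between [p] and [q] last, so that they lead up to the first
   vertex. *)
apply: (@generic_height_perm _ _ n (steps x) (rotate 0 (J 1%N) q)
  J p q (J 1%N - (q - p))%N 1%N cJ Gx) => //.
- by apply: permutes_rotate; lia.
- by apply: rotate_vertices => //; lia.
- by lia.
- by apply: vertex_low; lia.
- right; have h r := @walk_rotate2 _ (steps x) 0 (J 1%N) q r.
  have := h q; have := h p; rewrite !add0n subnK; last by lia.
  have -> : (J 1%N - q + p = J 1%N - (q - p))%N by lia.
  move=> /(_ _)/wrap[]; first by lia.
  move=> e1 /(_ _)/wrap[]; first by lia.
  move=> e2; rewrite walk0 !subr0 in e1 e2.
  by rewrite -e1 -e2 opprB addrA subrK.
Qed.

Lemma distinct_high x p q b : generic_set x -> (J d.+1 <= p < q)%N -> (q <= n)%N ->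
  level (dir b J) x p <> level (dir b J) x q.
Proof.
move=> Gx pq qn; apply: level_neq.
have win l : (1 <= l <= d.+1)%N ->
    (J l <= J d.+1)%N \/ (J d.+1 + (n - J d.+1) <= J l)%N.
  by move=> ld; left; apply: (chain_le cJ); lia.
have cle : (p - J d.+1 <= n - J d.+1)%N by lia.
apply: (@generic_height_perm _ _ n (steps x) (rotate (J d.+1) (n - J d.+1) (p - J d.+1))
  J p q (J d.+1 + (q - p))%N d.+1 cJ Gx) => //.
- by apply: permutes_rotate; lia.
- exact: rotate_vertices.
- by lia.
- by lia.
- by apply: vertex_high; lia.
- left; rewrite [X in _ - X](rotate_vertices _ cle win); last by lia.
  by rewrite walk_rotate1; [congr (walk _ _ - walk _ _)|]; lia.
Qed.

Lemma chain_locate p : (J 1%N <= p < J d.+1)%N ->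
  exists2 k, (1 <= k <= d)%N & (J k <= p < J k.+1)%N.
Proof.
move=> /andP[J1p]; elim: {-2}d (leqnn d) => [|m IH] md pJ; first by lia.
have [pm|pm] := ltnP p (J m.+1); last by exists m.+1; lia.
by have [k km kp] := IH (ltnW md) pm; exists k => //; lia.
Qed.

Lemma below_blocks b : below b J =
  blocks b J d `&` min_at (dir b J) 0 (J 1%N) (J 1%N) `&`
  min_at (dir b J) (J d.+1) (n - J d.+1) (J d.+1).
Proof.
apply/seteqP; split=> x /=.
  move=> H; split; first split.
  - move=> k kd q qk; rewrite level_vertex; last by lia.
    have Jn : (J k.+1 <= n)%N by apply: (chain_leq cJ); lia.
    by apply: H; [lia|apply: (vertex_between kd); lia].
  - move=> q qJ qJ1; apply: H; last by apply: vertex_low; lia.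
    have J1n : (J 1%N <= n)%N by apply: (chain_leq cJ).
    by lia.
  - move=> q qJ qJ1; rewrite level_vertex; last by lia.
    have := cJ.2 => Jn; apply: H; first by lia.
    by apply: vertex_high; lia.
move=> [[H1 H2] H3] p pn Jp.
have [p1|p1] := ltnP p (J 1%N); first by apply: H2; lia.
have [pd|pd] := ltnP p (J d.+1).
  have [k kd kp] := chain_locate (introT andP (conj p1 pd)).
  rewrite -(@level_vertex b J x k); last by lia.
  apply: H1 => //; have : p <> J k by move=> e; apply: Jp; exists k => //; lia.
  by lia.
rewrite -(@level_vertex b J x d.+1); last by lia.
apply: H3; first by lia.
by move=> e; apply: Jp; exists d.+1 => //; lia.
Qed.

(** For generic steps no other point lies on the hyperplane of the simplex: the weak inequalities of
    [facet] become strict and its last clause concerns only the vertices. *)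
Lemma facet_below x : (d.+1 <= n)%N -> generic_set x ->
  facet n (walk (steps x)) J <-> below false J x \/ below true J x.
Proof.
move=> dn Gx; set N := normal (edge (walk (steps x)) J).
have NE p : (p <= n)%N -> ~ vertex (d := d) J p ->
    height N (walk (steps x) p) <> height N (walk (steps x) (J 1%N)).
  move=> pn Jp e; apply: (generic_height cJ Gx pn Jp).
  by rewrite heightB -/N e subrr.
have vE p : vertex (d := d) J p ->
    height N (walk (steps x) p) = height N (walk (steps x) (J 1%N)).
  by move=> [k kd <-]; rewrite height_vertex.
have lvlF p : level (dir false J) x p = height N (walk (steps x) p).
  by rewrite level_dirE expr0 mul1r.
have lvlT p : level (dir true J) x p = - height N (walk (steps x) p).
  by rewrite level_dirE expr1 mulN1r.
split=> [[_ side _]|H].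
  case: side => side; [left|right] => p pn Jp; rewrite ?lvlF ?lvlT;
    have := side p pn; rewrite heightB; have /eqP := NE p pn Jp; lra.
split.
- have [p pn Jp] := @exists_nonvertex d n J dn.
  apply/eqP => N0; apply: (NE p pn Jp).
  by rewrite /N N0 /height !mulmx0.
- case: H => H; [left|right] => p pn; rewrite heightB;
    (have [Jp|Jp] := pselect (vertex (d := d) J p); first by rewrite vE// subrr);
    have := H p pn Jp; rewrite ?lvlF ?lvlT; lra.
- move=> p pn; rewrite heightB => /eqP; rewrite subr_eq0 => /eqP Np.
  have Jp : vertex (d := d) J p.
    apply: contrapT => Jp; exact: (NE p pn Jp Np).
  have [k kd Jk] := Jp; rewrite -Jk.
  apply/in_simplexP.
  + have [q qn Jq] := @exists_nonvertex d n J dn.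
    apply/eqP => N0; apply: (NE q qn Jq).
    by rewrite /N N0 /height !mulmx0.
  + by rewrite heightB height_vertex// subrr.
  + by apply: sub_conv_hull; exists k.
Qed.

Lemma below_exclusive x : (d.+1 <= n)%N -> below false J x -> below true J x -> False.
Proof.
move=> dn H1 H2; have [p pn Jp] := @exists_nonvertex d n J dn.
have := H1 p pn Jp; have := H2 p pn Jp.
by rewrite !level_dirE !expr0 !expr1 !mulN1r !mul1r; lra.
Qed.

End vertices.

Lemma measurable_blocks b J m : measurable (blocks b J m).
Proof.
apply: measurable_forall => k; apply: measurable_imply.
by apply: measurable_excursion; exact: measurable_dir_dir.
Qed.

Lemma measurable_below b J : measurable (below b J).
Proof.
apply: measurable_forall => k; apply: measurable_imply; apply: measurable_imply.
by apply: measurable_ltr; apply: measurable_level; exact: measurable_dir_dir.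
Qed.

End facet_events.

Section facet_probabilities.
Context {R : realType} {d n : nat}.
Local Notation V := 'rV[R]_d.+1.
Local Notation C := (n.-tuple V).
Implicit Types (x y : C) (J : nat -> nat) (b : bool).

Variable mu : probability C R.
Hypothesis exch : forall f, permutes n f -> invariant_under mu (relabel f).
Hypothesis mG : measurable (@generic_set R d n).
Hypothesis muG : mu (~` @generic_set R d n) = 0%E.
Local Notation pr := (pr mu).

Definition gaps J m : R := \prod_(1 <= k < m.+1) ((J k.+1 - J k)%:R)^-1.

Definition slide J i k := (i + (J k - J 1%N))%N.

Lemma dir_edges b J J' x y :
  (forall k, (1 <= k <= d)%N -> edge (walk (steps y)) J' k = edge (walk (steps x)) J k) ->
  dir b J' y = dir b J x.
Proof. by move=> e; rewrite /dir (eq_normal e). Qed.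

Lemma dir_vertices b J x y :
  (forall k, (1 <= k <= d.+1)%N -> walk (steps y) (J k) = walk (steps x) (J k)) ->
  dir b J y = dir b J x.
Proof. by move=> e; apply: dir_edges => k kd; rewrite /edge !e//; lia. Qed.

Lemma blocks_congr b J J' x y m : (m <= d)%N ->
  (forall k p, (1 <= k <= m)%N -> (p <= J k.+1 - J k)%N ->
     level (dir b J') y (J' k + p)%N - level (dir b J') y (J' k) =
     level (dir b J) x (J k + p)%N - level (dir b J) x (J k)) ->
  (forall k, (1 <= k <= m)%N -> (J' k.+1 - J' k = J k.+1 - J k)%N) ->
  blocks b J' m y <-> blocks b J m x.
Proof.
move=> md lvl JJ'.
suff E k : (1 <= k <= m)%N ->
    excursion (dir b J') (J' k) (J' k.+1 - J' k) y <->
    excursion (dir b J) (J k) (J k.+1 - J k) x.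
  by split=> H k km; apply/(E k km)/H.
move=> km; have {}lvl p := lvl k p km; rewrite (JJ' k km) => {JJ'}.
split=> H q qk.
- have [r -> rk] : exists2 r, q = (J k + r)%N & (0 < r < J k.+1 - J k)%N.
    by exists (q - J k)%N; lia.
  rewrite -subr_gt0 -lvl ?subr_gt0; first by apply: H; lia.
  by lia.
- have [r -> rk] : exists2 r, q = (J' k + r)%N & (0 < r < J k.+1 - J k)%N.
    by exists (q - J' k)%N; lia.
  rewrite -subr_gt0 lvl ?subr_gt0; first by apply: H; lia.
  by lia.
Qed.

(** The blocks are added one at a time, the earlier ones forming the stable event. A rotation inside
    the new block moves no vertex, hence changes neither the normal nor the earlier blocks. *)
Lemma pr_blocks b J m : chain (d := d) n J -> (m <= d)%N ->
  pr (blocks b J m) = gaps J m.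
Proof.
move=> cJ; elim: m => [|m IH] md.
  rewrite /gaps big_nil (_ : blocks b J 0 = setT) ?pr_setT//.
  by apply/seteqP; split=> x //= _ k k0; lia.
have -> : (blocks b J m.+1 : set C) =
    blocks b J m `&` excursion (dir b J) (J m.+1) (J m.+2 - J m.+1).
  apply/seteqP; split=> x /=.
    by move=> H; split; [move=> k km; apply: H; lia|apply: H; lia].
  move=> [H1 H2] k km; have [e|km'] : k = m.+1 \/ (1 <= k <= m)%N by lia.
    by rewrite e.
  exact: H1.
have Jm : (J m.+1 < J m.+2)%N by apply: cJ.1; lia.
have Jn : (J m.+2 <= n)%N by apply: (chain_leq cJ); lia.
have win l : (1 <= l <= d.+1)%N ->
    (J l <= J m.+1)%N \/ (J m.+1 + (J m.+2 - J m.+1) <= J l)%N.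
  move=> ld; have [lm|lm] := leqP l m.+1; [left; apply: (chain_le cJ); lia|right].
  by rewrite subnKC ?(ltnW Jm)//; apply: (chain_le cJ); lia.
have dirE c x : (c < J m.+2 - J m.+1)%N ->
    dir b J (relabel (rotate (J m.+1) (J m.+2 - J m.+1) c) x) = dir b J x.
  move=> ca; apply: dir_vertices => k kd; rewrite walk_relabel ?(chain_leq cJ)//.
  by apply: rotate_vertices => //; exact: ltnW.
rewrite (pr_excursion mG muG).
- by rewrite IH ?(ltnW md)// /gaps [in RHS]big_nat_recr.
- by rewrite subn_gt0.
- by rewrite subnKC// ltnW.
- exact: measurable_dir_dir.
- exact: measurable_blocks.
- by move=> c ca; apply: exch; apply: permutes_rotate; lia.
- move=> c x ca; apply: blocks_congr; [exact: ltnW| |by []].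
  move=> k p km pk; have Jk : (J k.+1 <= J m.+1)%N by apply: (chain_le cJ); lia.
  have Jkk : (J k < J k.+1)%N by apply: cJ.1; lia.
  rewrite /level dirE// !walk_relabel; [|lia|lia].
  by rewrite !walk_rotate_low//; lia.
- by move=> c x ca; exact: dirE.
- move=> x _; rewrite subnKC ?(ltnW Jm)//.
  by rewrite level_vertex 1?[in RHS]level_vertex//; lia.
- move=> x p q Gx pq qJ; apply: (@distinct_block _ _ _ J cJ x m.+1) => //; [lia..|].
  by move=> [e1 e2]; lia.
Qed.

Lemma chain_shift J i : chain (d := d) n J -> (i <= n - (J d.+1 - J 1%N))%N ->
  chain (d := d) n (slide J i).
Proof.
move=> cJ iJ; split=> [k kd|]; rewrite /slide.
  have := cJ.1 k kd; have : (J 1%N <= J k)%N by apply: (chain_le cJ); lia.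
  by lia.
have : (J 1%N <= J d.+1)%N by apply: (chain_le cJ).
by have := cJ.2; lia.
Qed.

(* Rotating the first [i + L] steps by [L] moves the blocks from position [0]
   to position [i]; the [i] steps that follow them are moved in front. *)
Lemma below_shift b J i : chain (d := d) n J -> (i <= n - (J d.+1 - J 1%N))%N ->
  let L := (J d.+1 - J 1%N)%N in
  (relabel (rotate 0 (i + L) L) @^-1` below b (slide J i) : set C) =
  blocks b (slide J 0) d `&` min_at (dir b (slide J 0)) L (n - L) (L + i)%N.
Proof.
move=> cJ iJ L.
have Jle k : (1 <= k <= d.+1)%N -> (J 1%N <= J k <= J d.+1)%N.
  by move=> kd; rewrite !(chain_le cJ)//; lia.
have Ln : (L <= n)%N by have := cJ.2; rewrite /L; lia.
have i_n : (i + L <= n)%N by rewrite -/L in iJ; lia.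
have cJi := chain_shift cJ iJ; have cJ0 := @chain_shift J 0 cJ (leq0n _).
have J1i j : slide J j 1 = j by rewrite /slide subnn addn0.
have Jdi j : slide J j d.+1 = (j + L)%N by [].
apply/funext => x; apply/propext; rewrite /preimage /= (below_blocks cJi).
set y := relabel _ x; rewrite J1i Jdi.
have w1 p : (p <= i)%N ->
    walk (steps y) p = walk (steps x) (L + p)%N - walk (steps x) L.
  move=> pi; rewrite walk_relabel; last by lia.
  have := @walk_rotate1 _ (steps x) 0 (i + L) L p.
  by rewrite walk0 subr0 !add0n; apply; lia.
have w2 p : (p <= L)%N ->
    walk (steps y) (i + p)%N - walk (steps y) i = walk (steps x) p.
  move=> pL; rewrite !walk_relabel; [|lia|lia].
  have := @walk_rotate2 _ (steps x) 0 (i + L) L p.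
  by rewrite addnK walk0 subr0 !add0n; apply; lia.
have w3 p : (i + L <= p <= n)%N -> walk (steps y) p = walk (steps x) p.
  move=> pL; rewrite walk_relabel; last by lia.
  by rewrite walk_rotate_high//; lia.
have wd p q : (p <= L)%N -> (q <= L)%N ->
    walk (steps y) (i + q)%N - walk (steps y) (i + p)%N =
    walk (steps x) q - walk (steps x) p.
  by move=> pL qL; rewrite -!w2// opprB addrA subrK.
have Jk k : (1 <= k <= d.+1)%N -> (J k - J 1%N <= L)%N.
  by move=> kd; have := Jle k kd; lia.
have dE : dir b (slide J i) y = dir b (slide J 0) x.
  by apply: dir_edges => k kd; rewrite /edge /slide wd ?add0n ?Jk//; lia.
have l0 : level (dir b (slide J 0)) x 0 = 0.
  by rewrite /level walk0 /height mul0mx mxE.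
have lL : level (dir b (slide J 0)) x L = 0.
  have := @level_vertex _ _ _ b (slide J 0) x d.+1.
  by rewrite Jdi J1i l0 add0n; apply; rewrite ltnS leqnn.
have l1 p : (p <= i)%N ->
    level (dir b (slide J i)) y p = level (dir b (slide J 0)) x (L + p)%N.
  by move=> pi; rewrite /level dE w1// heightB -/(level _ _ L) lL subr0.
have l3 p : (i + L <= p <= n)%N ->
    level (dir b (slide J i)) y p = level (dir b (slide J 0)) x p.
  by move=> pi; rewrite /level dE w3.
have lB : blocks b (slide J i) d y <-> blocks b (slide J 0) d x.
  apply: blocks_congr; [by []| |by move=> k _; rewrite /slide; lia].
  move=> k p kd; rewrite /slide => pk.
  have h1 : (1 <= k <= d.+1)%N by lia.
  have h2 : (1 <= k.+1 <= d.+1)%N by lia.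
  have [/andP[e1 _] /andP[e2 _]] := (Jle k h1, Jle k.+1 h2).
  have [e3 e4] := (Jk k h1, Jk k.+1 h2).
  rewrite /level dE -!heightB add0n -addnA wd//; lia.
have lv : level (dir b (slide J i)) y (i + L)%N = level (dir b (slide J i)) y i.
  have := @level_vertex _ _ _ b (slide J i) y d.+1.
  by rewrite Jdi J1i; apply; rewrite ltnS leqnn.
split.
- move=> -[[/lB HB H1] H2]; split=> // q qL qi.
  have [qi'|qi'] := ltnP q (L + i)%N.
    have := H1 (q - L)%N; have qLi : (q - L <= i)%N by lia.
    rewrite (l1 i (leqnn i)) (l1 _ qLi).
    by rewrite subnKC; [apply; lia|lia].
  have qiL : (i + L <= q <= n)%N by lia.
  have := H2 q; rewrite lv (l1 i (leqnn i)) (l3 _ qiL).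
  by apply; lia.
- move=> [HB H]; split; first split.
  + exact/lB.
  + move=> q qi qi'; rewrite (l1 i (leqnn i)) (l1 _ qi).
    by apply: H; lia.
  + move=> q qi qi'; have qiL : (i + L <= q <= n)%N by lia.
    by rewrite lv (l1 i (leqnn i)) (l3 _ qiL); apply: H; lia.
Qed.

Lemma sum_pr_below b J : chain (d := d) n J ->
  \sum_(0 <= i < (n - (J d.+1 - J 1%N)).+1) pr (below b (slide J i)) = gaps J d.
Proof.
move=> cJ; set L := (J d.+1 - J 1%N)%N.
have cJ0 := @chain_shift J 0 cJ (leq0n _).
have Ln : (L <= n)%N by have := cJ.2; rewrite /L; lia.
have Jd0 : slide J 0 d.+1 = L by [].
have -> : gaps J d = gaps (slide J 0) d.
  apply: eq_big_nat => k kd; congr (_%:R^-1); rewrite /slide.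
  have : (J 1%N <= J k)%N by apply: (chain_le cJ); lia.
  by lia.
rewrite -(@pr_blocks b) //.
have dist x p q : generic_set x -> (L <= p < q)%N -> (q <= n)%N ->
    level (dir b (slide J 0)) x p <> level (dir b (slide J 0)) x q.
  by move=> Gx pq qn; apply: (distinct_high cJ0).
have lohi : (L <= n <= n)%N by rewrite Ln leqnn.
have oan : (L + (n - L) <= n)%N by rewrite subnKC.
(* With the blocks at the front, the rest of the walk visits the [(n - L).+1] positions [L], ...,
   [n]; these index both the partition and the terms of the sum. *)
have := @pr_partition _ _ _ mu _ mG muG (n - L).+1
  (fun i => min_at (dir b (slide J 0)) L (n - L) (L + i)%N)
  (blocks b (slide J 0) d) (measurable_blocks _ _ _).
move=> /(_ _)/wrap[].
  by move=> i _; apply: measurable_min_at; exact: measurable_dir_dir.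
move=> /(_ _)/wrap[].
  by move=> x _ Gx; apply: (exists_min_at lohi dist Gx (leqnn L) oan).
move=> /(_ _)/wrap[].
  by move=> x c c' _ _ cn c'n; exact: (min_at_uniq lohi).
move=> ->; apply: eq_big_nat => i iL; rewrite ltnS in iL.
rewrite -(below_shift b cJ iL).
have rot : permutes n (rotate 0 (i + L) L) by apply: permutes_rotate; lia.
by rewrite (pr_invariant (exch rot) (measurable_below _ _)).
Qed.

Lemma measurable_facet_steps J : chain (d := d) n J ->
  measurable [set x : C | facet n (walk (steps x)) J].
Proof.
move=> cJ; apply: (measurable_facet (S := fun k x => walk (steps x) k)).
  by move=> k _; exact: measurable_walk_steps.
by move=> k kd; exact: (chain_leq cJ).
Qed.

Lemma pr_facet J : (d.+1 <= n)%N -> chain (d := d) n J ->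
  pr [set x | facet n (walk (steps x)) J] = pr (below false J) + pr (below true J).
Proof.
move=> dn cJ; set F := [set x : C | _].
have mF : measurable F by exact: measurable_facet_steps.
have := @pr_partition _ _ _ mu _ mG muG 2 (fun c => below (c == 1%N) J) F mF.
move=> /(_ _)/wrap[]; first by move=> c _; exact: measurable_below.
move=> /(_ _)/wrap[].
  by move=> x Fx Gx; have [H|H] := (facet_below cJ dn Gx).1 Fx; [exists 0%N|exists 1%N].
move=> /(_ _)/wrap[].
  move=> x [|[|c]] [|[|c']] // _ _ _ _ h1 h2.
    by have := below_exclusive dn h1 h2.
  by have := below_exclusive dn h2 h1.
rewrite big_nat_recr// big_nat1 /= => ->.
have FB b : pr (F `&` below b J) = pr (below b J).
  rewrite -(pr_setIfull mG muG); last by apply: measurableI => //; exact: measurable_below.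
  rewrite -[RHS](pr_setIfull mG muG); last exact: measurable_below.
  congr pr; apply/seteqP; split=> x /=; first by move=> [[_ ?] ?].
  move=> [Bx Gx]; split=> //; split=> //; apply/(facet_below cJ dn Gx).
  by case: b Bx => Bx; [right|left].
by rewrite !FB.
Qed.

Lemma sum_pr_facet J : (d.+1 <= n)%N -> chain (d := d) n J ->
  \sum_(0 <= i < (n - (J d.+1 - J 1%N)).+1)
    pr [set x | facet n (walk (steps x)) (slide J i)] = 2 * gaps J d.
Proof.
move=> dn cJ.
rewrite (eq_big_nat _ _ (F2 := fun i =>
  pr (below false (slide J i)) + pr (below true (slide J i)))); last first.
  by move=> i iL; apply: pr_facet => //; exact: chain_shift.
by rewrite big_split /= !sum_pr_below// mulr2n mulrDl mul1r.
Qed.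

Section symmetric.
Hypothesis flip_inv : forall o a, (o + a <= n)%N -> invariant_under mu (flip_window o a).

Lemma walk_flip_diff x o a p q : (o + a <= n)%N -> (p <= n)%N -> (q <= n)%N ->
  (o + a <= p)%N /\ (o + a <= q)%N \/ (p <= o)%N /\ (q <= o)%N ->
  walk (steps (flip_window o a x)) q - walk (steps (flip_window o a x)) p =
  walk (steps x) q - walk (steps x) p.
Proof.
move=> oan pn qn; rewrite !walk_flip//; case=> -[op oq]; last first.
  by rewrite !walk_reflect_low.
have h r := @walk_reflect_high _ (steps x) o a r.
have := h (p - (o + a))%N; have := h (q - (o + a))%N; rewrite !subnKC// => e1 e2.
have base (v w z : V) : v - w = (v - z) - (w - z) by rewrite opprB addrA subrK.
rewrite [LHS](base _ _ (walk (reflect_steps o a (steps x)) (o + a)%N)) e1 e2.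
by rewrite -base.
Qed.

Lemma pr_below_symmetric b J : chain (d := d) n J ->
  pr (below b J) = arcsine (J 1%N) * arcsine (n - J d.+1) * gaps J d.
Proof.
move=> cJ; rewrite (below_blocks cJ).
have J1d : (J 1%N <= J d.+1)%N by apply: (chain_le cJ).
have Jdn := cJ.2.
have dflip o a x : (o + a <= J 1%N)%N \/ (J d.+1 <= o)%N -> (o + a <= n)%N ->
    dir b J (flip_window o a x) = dir b J x.
  move=> oJ oan; apply: dir_edges => k kd.
  have k1 : (J 1%N <= J k <= J d.+1)%N by rewrite !(chain_le cJ)//; lia.
  have k2 : (J 1%N <= J k.+1 <= J d.+1)%N by rewrite !(chain_le cJ)//; lia.
  by rewrite /edge walk_flip_diff//; lia.
have bflip o a x : (o + a <= J 1%N)%N \/ (J d.+1 <= o)%N -> (o + a <= n)%N ->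
    blocks b J d (flip_window o a x) <-> blocks b J d x.
  move=> oJ oan; apply: blocks_congr => [||//]; first by [].
  move=> k p kd pk.
  have k1 : (J 1%N <= J k <= J d.+1)%N by rewrite !(chain_le cJ)//; lia.
  have k2 : (J 1%N <= J k.+1 <= J d.+1)%N by rewrite !(chain_le cJ)//; lia.
  by rewrite /level dflip// -!heightB walk_flip_diff//; lia.
have mdir : measurable_dir (dir b J) := @measurable_dir_dir R d n b J.
have J1n : (0 <= J 1%N <= n)%N by rewrite (leq_trans J1d Jdn).
have Jdnn : (J d.+1 <= n <= n)%N by rewrite Jdn leqnn.
have inv0 o a : (0 <= o)%N -> (o + a <= J 1%N)%N -> invariant_under mu (flip_window o a).
  by move=> _ oa; apply: flip_inv; lia.
have dflip0 o a x : (0 <= o)%N -> (o + a <= J 1%N)%N ->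
    dir b J (flip_window o a x) = dir b J x.
  by move=> _ oa; apply: dflip; lia.
have bflip0 : flip_stable 0 (J 1%N) (blocks b J d : set C).
  by move=> o a x _ oa; apply: bflip; lia.
have dist0 x p q : generic_set x -> (0 <= p < q)%N -> (q <= J 1%N)%N ->
    level (dir b J) x p <> level (dir b J) x q.
  by move=> Gx pq qJ; apply: (distinct_low cJ Gx); lia.
have inv1 o a : (J d.+1 <= o)%N -> (o + a <= n)%N -> invariant_under mu (flip_window o a).
  by move=> _; exact: flip_inv.
have dflip1 o a x : (J d.+1 <= o)%N -> (o + a <= n)%N ->
    dir b J (flip_window o a x) = dir b J x.
  by move=> od oa; apply: dflip => //; right.
have dist1 x p q : generic_set x -> (J d.+1 <= p < q)%N -> (q <= n)%N ->
    level (dir b J) x p <> level (dir b J) x q.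
  exact: (distinct_high cJ).
set D := blocks b J d `&` min_at (dir b J) 0 (J 1%N) (J 1%N).
have mB := @measurable_blocks R d n b J d.
have mD : measurable D.
  exact: (measurableI _ _ mB (measurable_min_at _ _ _ mdir)).
have Dflip : flip_stable (J d.+1) (n - J d.+1) D.
  move=> o a x od oa; have oan : (o + a <= n)%N by lia.
  have [b1 b2] := bflip o a x (or_intror od) oan.
  have lvl p : (p <= J 1%N)%N ->
      level (dir b J) (flip_window o a x) p = level (dir b J) x p.
    move=> pJ; rewrite /level dflip1// walk_flip ?walk_reflect_low//; lia.
  split=> -[Dx Hx]; split; [exact: b1| |exact: b2|] => q qi qoi;
    have qJ : (q <= J 1%N)%N by lia.
    by rewrite -(lvl _ (leqnn _)) -(lvl _ qJ); exact: Hx.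
  by rewrite (lvl _ (leqnn _)) (lvl _ qJ); exact: Hx.
have oan : (J d.+1 + (n - J d.+1) <= n)%N by rewrite subnKC.
(* The stretch after the last vertex is removed first, [D] being stable under its reflections.
   Before the first vertex the minimum sits at the end of the stretch and is first reflected to the
   start. *)
rewrite (pr_min_at_start mG muG Jdnn mdir inv1 dflip1 dist1 (leqnn _) oan mD Dflip).
have := pr_min_at_end J1n mdir inv0 dflip0 (leqnn 0) (leqnn (0 + J 1%N)) mB bflip0.
rewrite add0n -/D => ->.
have := pr_min_at_start mG muG J1n mdir inv0 dflip0 dist0 (leqnn 0)
  (leqnn (0 + J 1%N)) mB bflip0.
by move=> ->; rewrite (pr_blocks b cJ (leqnn d)) mulrCA mulrA.
Qed.

Lemma pr_facet_symmetric J : (d.+1 <= n)%N -> chain (d := d) n J ->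
  pr [set x | facet n (walk (steps x)) J] =
  2 * arcsine (J 1%N) * arcsine (n - J d.+1) * gaps J d.
Proof. by move=> dn cJ; rewrite pr_facet// !pr_below_symmetric//; ring. Qed.

End symmetric.

End facet_probabilities.

(** * Transfer from the sample space to the law of the steps *)

Section configuration.
Context {R : realType} {d : nat} {disp : measure_display}.
Context {T : measurableType disp} (P : probability T R).
Local Notation V := 'rV[R]_d.+1.

(** Positions count from 0 and increments from 1, hence [X k.+1] at position [k]. Rearrangements act
    on such tuples, not on the sample space. *)
Definition config n (X : nat -> {RV P >-> V}) (w : T) : n.-tuple V :=
  [tuple X k.+1 w | k < n].

Lemma measurable_config n X : measurable_fun setT (config n X).
Proof.
apply/measurable_fun_tnthP => i.
apply: (eq_measurable_fun (X i.+1)); last exact: measurable_funPT.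
by move=> w _ /=; rewrite tnth_mktuple.
Qed.

HB.instance Definition _ n X :=
  isMeasurableFun.Build _ _ _ _ (config n X) (@measurable_config n X).

Definition law n (X : nat -> {RV P >-> V}) : probability (n.-tuple V) R :=
  distribution P (config n X : {RV P >-> n.-tuple V}).

Lemma lawE n X A : law n X A = P (config n X @^-1` A).
Proof. by []. Qed.

Lemma steps_config n X w j : (j < n)%N -> steps (config n X w) j = X j.+1 w.
Proof.
move=> jn; rewrite /steps /config (nth_map (Ordinal jn)) ?size_enum_ord//.
by rewrite nth_enum_ord.
Qed.

Lemma walk_config n X w p : (p <= n)%N ->
  walk (steps (config n X w)) p = psum X p w.
Proof.
move=> pn; rewrite /psum big_add1 /=; apply: eq_big_nat => j /andP[_ jp].
by rewrite steps_config//; lia.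
Qed.

End configuration.

Lemma measure_fin_bigcup0 {R : realType} {dC : measure_display}
    {C : measurableType dC} (mu : {measure set C -> \bar R})
    (I : finType) (D : {pred I}) (F : I -> set C) :
  (forall i, i \in D -> measurable (F i) /\ mu (F i) = 0%E) ->
  mu (\bigcup_(i in [set` D]) F i) = 0%E.
Proof.
move=> F0; rewrite bigcup_pred.
suff [] : measurable (\big[setU/set0]_(i in D) F i) /\
  mu (\big[setU/set0]_(i in D) F i) = 0%E by [].
elim/big_ind : _ => [|A B [mA A0] [mB B0]|i iD]; last exact: F0.
- by split; [exact: measurable0|rewrite measure0].
- by split; [exact: measurableU|rewrite measureU0].
Qed.

Section generic_law.
Context {R : realType} {d n : nat}.
Local Notation V := 'rV[R]_d.+1.
Local Notation C := (n.-tuple V).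
Variable mu : probability C R.

Definition in_position : set C := [set x | general_position n (walk (steps x))].

Definition nat_perm (s : 'S_n) (j : nat) : nat :=
  if insub j is Some i then s i else j.

Lemma nat_permE s (i : 'I_n) : nat_perm s i = s i.
Proof. by rewrite /nat_perm insubT//= => jn; congr (val (s _)); apply: val_inj. Qed.

Lemma permutes_nat_perm s : permutes n (nat_perm s).
Proof.
split=> [j jn|j k jn kn]; first by rewrite (nat_permE s (Ordinal jn)).
rewrite (nat_permE s (Ordinal jn)) (nat_permE s (Ordinal kn)).
by move=> /val_inj/perm_inj/(congr1 val).
Qed.

Lemma permutesP (f : nat -> nat) : permutes n f -> exists s : 'S_n, forall i : 'I_n, f i = s i.
Proof.
move=> [fn fi]; pose g (i : 'I_n) := Ordinal (fn i (ltn_ord i)).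
have ginj : injective g.
  by move=> i j /(congr1 val)/= /fi => /(_ (ltn_ord i) (ltn_ord j))/val_inj.
by exists (perm ginj) => i; rewrite permE.
Qed.

Lemma eq_relabel (f g : nat -> nat) (x : C) : (forall i : 'I_n, f i = g i) ->
  relabel f x = relabel g x.
Proof. by move=> fg; apply: eq_mktuple => i; rewrite fg. Qed.

Lemma eq_general_position (S S' : nat -> V) :
  (forall p, (1 <= p <= n)%N -> S p = S' p) ->
  general_position n S -> general_position n S'.
Proof.
move=> SS' gS J Jinj.
suff <- : \matrix_(k < d.+1) S (J k).+1 = \matrix_(k < d.+1) S' (J k).+1 by exact: gS.
by apply/row_matrixP => k; rewrite !rowK SS' ?ltn_ord.
Qed.

Lemma in_position_relabel f (x : C) :
  in_position (relabel f x) <-> general_position n (walk (steps x \o f)).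
Proof.
split; apply: eq_general_position => p /andP[_ pn]; rewrite walk_relabel//.
Qed.

(** Only the values of a rearrangement below [n] matter, so a finite intersection over ['S_n]
    suffices; this gives measurability and lets null sets be added up. *)
Lemma generic_setE :
  @generic_set R d n = \bigcap_(s in [set: 'S_n]) (relabel (nat_perm s) @^-1` in_position).
Proof.
apply/seteqP; split=> x /= H.
  by move=> s _; apply/in_position_relabel; exact/H/permutes_nat_perm.
move=> f nf; have [s fs] := permutesP nf.
apply/in_position_relabel; rewrite (@eq_relabel _ (nat_perm s)); first exact: H.
by move=> i; rewrite nat_permE.
Qed.

Lemma measurable_in_position : measurable in_position.
Proof.
rewrite (_ : in_position = \bigcap_(J in [set J : {ffun 'I_d.+1 -> 'I_n} | injective J])
  ~` [set x | \det (\matrix_(k < d.+1) walk (steps x) (J k).+1) = 0]); last first.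
  apply/seteqP; split=> x /= H.
    move=> J Jinj; have := H J Jinj.
    by rewrite row_free_unit unitmxE unitfE => /eqP.
  move=> J Jinj; rewrite row_free_unit unitmxE unitfE; apply/eqP.
  have Jf : injective [ffun k => J k] by move=> k l; rewrite !ffunE; exact: Jinj.
  suff <- : \matrix_(k < d.+1) walk (steps x) ([ffun k => J k] k).+1 =
            \matrix_(k < d.+1) walk (steps x) (J k).+1 by exact: (H _ Jf).
  by apply/row_matrixP => k; rewrite !rowK ffunE.
apply: fin_bigcap_measurable => [|J _]; first exact: finite_finset.
apply: measurableC; apply: measurable_eqr; last exact: measurable_cst.
apply: measurable_det => i j; under eq_fun do rewrite mxE.
by have /measurable_rVP := @measurable_walk_steps R d n (J i).+1; exact.
Qed.

Lemma measurable_generic_set : measurable (@generic_set R d n).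
Proof.
rewrite generic_setE; apply: fin_bigcap_measurable => [|s _]; first exact: finite_finset.
rewrite -[X in measurable X]setTI.
by apply: measurable_relabel => //; exact: measurable_in_position.
Qed.

(** Each rearranged walk has the law of the original one, so the exceptional set is a finite union
    of null sets. *)
Lemma generic_set_full :
  (forall f, permutes n f -> invariant_under mu (relabel f)) ->
  mu (~` in_position) = 0%E -> mu (~` @generic_set R d n) = 0%E.
Proof.
move=> exch mu0; have mI := measurable_in_position.
rewrite generic_setE setC_bigcap.
rewrite (_ : [set: 'S_n] = [set` predT]); last by apply/seteqP; split.
apply: measure_fin_bigcup0 => s _; split.
  apply: measurableC; rewrite -[X in measurable X]setTI.
  by apply: measurable_relabel.
rewrite preimage_setC.
exact: (eq_trans (exch _ (permutes_nat_perm s) _ (measurableC mI)) mu0).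
Qed.

End generic_law.

Section facet_congruence.
Context {R : realType} {d : nat}.
Local Notation V := 'rV[R]_d.+1.
Implicit Types (S : nat -> V) (J : nat -> nat).

Lemma eq_frame v (B B' : nat -> V) : (forall k, (1 <= k <= d)%N -> B k = B' k) ->
  frame v B = frame v B'.
Proof.
move=> BB'; apply/row_matrixP => k; rewrite !rowK; case: eqP => // k0.
exact/BB'/ord_neq0_range.
Qed.

(** The condition sees a configuration only through the edges and the displacements from the first
    vertex. The order of the points is irrelevant, so a closed polygon may be read from another
    starting point. *)
Lemma facet_congr n n' S S' J J' :
  (forall k, (1 <= k <= d)%N -> edge S J k = edge S' J' k) ->
  (forall p, (p <= n')%N -> exists2 q, (q <= n)%N &
     S' p - S' (J' 1%N) = S q - S (J 1%N)) ->
  facet n S J -> facet n' S' J'.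
Proof.
move=> e pq [N0 side flat].
have eN : normal (edge S' J') = normal (edge S J) by apply/esym/eq_normal.
split; rewrite eN //.
  case: side => side; [left|right] => p /pq[q qn ->]; exact: side.
move=> p /pq[q qn ->] h k kd; have := flat q qn h k kd.
by rewrite /bary eN (eq_frame _ e).
Qed.

Lemma eq_facet n S S' J J' :
  (forall p, (p <= n)%N -> S p = S' p) ->
  (forall k, (1 <= k <= d.+1)%N -> J k = J' k) ->
  (forall k, (1 <= k <= d.+1)%N -> (J k <= n)%N) ->
  facet n S J <-> facet n S' J'.
Proof.
move=> SS' JJ' Jn.
have SJ k : (1 <= k <= d.+1)%N -> S (J k) = S' (J' k).
  by move=> kd; rewrite -JJ'// SS'// Jn.
split; apply: facet_congr => [k kd|p pn].
- by rewrite /edge !SJ//; lia.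
- by exists p => //; rewrite SS'// SJ.
- by rewrite /edge !SJ//; lia.
- by exists p => //; rewrite SS'// SJ.
Qed.

End facet_congruence.

Section face_probability.
Context {R : realType} {d : nat} {disp : measure_display}.
Context {T : measurableType disp} (P : probability T R).
Local Notation V := 'rV[R]_d.+1.
Implicit Types (X : nat -> {RV P >-> V}) (J : nat -> nat).

(** The length [N] of the tuples may exceed [n] because a bridge has [n.+1] steps, while the hull is
    taken over the sums up to [n]. *)
Lemma face_eventE N n (S : nat -> T -> V) X J :
  (n <= N)%N -> (forall p, (p <= n)%N -> S p = psum X p) ->
  (forall k, (1 <= k <= d.+1)%N -> (J k <= n)%N) ->
  P (face_event n S J) =
  (pr (law N X) [set x | facet n (walk (steps x)) J])%:E.
Proof.
move=> nN SX Jn; rewrite -prE; last first.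
  apply: (measurable_facet (S := fun k x => walk (steps x) k)) => //.
  by move=> k _; exact: measurable_walk_steps.
rewrite lawE; congr (P _); apply/funext => w; apply/propext => /=.
rewrite /face_event /=.
apply: (iff_trans (@facetP R d n (S ^~ w) J Jn)).
by apply: eq_facet => // p pn; rewrite SX// walk_config// (leq_trans pn).
Qed.

Lemma law_exchangeable n X : exchangeable P n X ->
  forall f, permutes n f -> invariant_under (law n X) (relabel f).
Proof.
move=> eX f nf A mA; have [s fs] := permutesP nf.
rewrite !lawE; have := eX s A mA; rewrite -[RHS]/(P (config n X @^-1` A)) => <-.
congr (P _); apply/funext => w; congr (A _).
by apply: eq_mktuple => k; rewrite fs steps_config.
Qed.

Lemma law_in_position n X :
  {ae P, forall w, general_position n (psum X ^~ w)} ->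
  law n X (~` in_position) = 0%E.
Proof.
move=> [N [mN N0 sN]]; apply/eqP; rewrite eq_le measure_ge0 andbT -N0 lawE.
apply: le_measure; rewrite ?inE//.
  rewrite -[X in measurable X]setTI.
  by apply: measurable_config => //; apply: measurableC; exact: measurable_in_position.
apply: subset_trans sN => w /= H; apply: contra_not H.
by apply: eq_general_position => p /andP[_ pn]; rewrite walk_config.
Qed.

Lemma sum_face_probability n X J : (d.+1 <= n)%N -> chain (d := d) n J ->
  exchangeable P n X ->
  {ae P, forall w, general_position n (psum X ^~ w)} ->
  (\sum_(0 <= j < (n - J d.+1 + J 1%N).+1)
     P (face_event n (psum X) (fun k => (j + (J k - J 1%N))%N)))%E =
  (2 * gaps J d)%:E.
Proof.
move=> dn cJ eX gX.
have J1d : (J 1%N <= J d.+1)%N by apply: (chain_le cJ).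
have exch := law_exchangeable eX.
have muG := generic_set_full exch (law_in_position gX).
rewrite -(sum_pr_facet exch (measurable_generic_set) muG dn cJ).
have -> : (n - J d.+1 + J 1%N = n - (J d.+1 - J 1%N))%N by have := cJ.2; lia.
rewrite -sumEFin; apply: eq_big_nat => j /andP[_ jn].
apply: face_eventE => // k kd.
by apply: (chain_leq (chain_shift cJ _)).
Qed.

(* Rotating a closed polygon by one step translates its vertex set, so the
   probabilities do not depend on the starting index. *)
Lemma bridge_shift n (mu : probability (n.+1.-tuple V) R) J i :
  chain (d := d) n J -> (i < n - (J d.+1 - J 1%N))%N ->
  (forall f, permutes n.+1 f -> invariant_under mu (relabel f)) ->
  mu [set x | walk (steps x) n.+1 <> 0] = 0%E ->
  pr mu [set x | facet n (walk (steps x)) (slide J i.+1)] =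
  pr mu [set x | facet n (walk (steps x)) (slide J i)].
Proof.
move=> cJ iJ exch mu0.
have mF j : (j <= n - (J d.+1 - J 1%N))%N ->
    measurable [set x : n.+1.-tuple V | facet n (walk (steps x)) (slide J j)].
  move=> jn; apply: (measurable_facet (S := fun k x => walk (steps x) k)).
    by move=> k _; exact: measurable_walk_steps.
  by move=> k kd; apply: (chain_leq (chain_shift cJ jn)).
have rot : permutes n.+1 (rotate 0 n.+1 1) by apply: permutes_rotate.
rewrite -[RHS](pr_invariant (exch _ rot)); last exact: mF (ltnW iJ).
pose Z := [set x : n.+1.-tuple V | walk (steps x) n.+1 = 0].
have mZ : measurable Z.
  rewrite (_ : Z = [set x | forall p, (p <= d)%N ->
      walk (steps x) n.+1 ord0 (inord p) = 0]).
    apply: measurable_forall_le => p _; apply: measurable_eqr; last exact: measurable_cst.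
    by have /measurable_rVP := @measurable_walk_steps R d n.+1 n.+1; exact.
  apply/seteqP; split=> x /=; first by move=> -> p _; rewrite mxE.
  move=> H; apply/rowP => k; rewrite [RHS]mxE.
  by have := H k (leq_ord k); rewrite inord_val.
rewrite -(pr_setIfull mZ mu0 (mF _ iJ)) -[RHS](pr_setIfull mZ mu0); last first.
  by rewrite -[X in measurable X]setTI; apply: measurable_relabel => //; exact: mF (ltnW iJ).
congr pr; apply/funext => x; apply/propext; rewrite /setI /preimage /=.
suff E : Z x -> facet n (walk (steps x)) (slide J i.+1) <->
    facet n (walk (steps (relabel (rotate 0 n.+1 1) x))) (slide J i).
  by split=> -[h1 h2]; split=> //; [apply/(E h2)|apply/(E h2)].
move=> Zx; set y := relabel _ x.
have wy p : (p <= n)%N -> walk (steps y) p = walk (steps x) p.+1 - walk (steps x) 1.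
  move=> pn; rewrite walk_relabel; last by lia.
  have := @walk_rotate1 _ (steps x) 0 n.+1 1 p.
  by rewrite walk0 subr0 !add0n add1n; apply.
have ci := chain_shift cJ iJ.
have sn k : (1 <= k <= d.+1)%N -> (slide J i k <= n)%N.
  by move=> kd; apply: (chain_leq (chain_shift cJ (ltnW iJ))).
have sS k : slide J i.+1 k = (slide J i k).+1 by [].
have trans p q : (p <= n)%N -> (q <= n)%N ->
    walk (steps y) p - walk (steps y) q = walk (steps x) p.+1 - walk (steps x) q.+1.
  by move=> pn qn; rewrite !wy// opprB addrA subrK.
have ed k : (1 <= k <= d)%N ->
    edge (walk (steps x)) (slide J i.+1) k = edge (walk (steps y)) (slide J i) k.
  by move=> kd; rewrite /edge !sS trans// sn//; lia.
split; apply: facet_congr => [k kd|p pn].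
- exact: ed.
- have [pn'|pn'] := ltnP p n.
    by exists p.+1 => //; rewrite trans// sn.
  have -> : p = n by lia.
  by exists 0%N => //; rewrite trans// ?sn// Zx walk0.
- by rewrite ed.
- case: p pn => [_|p pn].
    by exists n => //; rewrite trans// ?sn// Zx walk0.
  by exists p; rewrite 1?ltnW// trans ?sn// ltnW.
Qed.

(** The sum formula is applied to [X], and the equality of its terms comes from the [n.+1]
    exchangeable steps [Y] of the bridge; both have the same sums up to [n]. The number of equal
    terms is the last factor of the denominator. *)
Lemma bridge_face_probability n X J : (d.+1 <= n)%N -> chain (d := d) n J ->
  exchangeable P n X ->
  {ae P, forall w, general_position n (psum X ^~ w)} ->
  random_bridge P n.+1 (fun k => if (k <= n)%N then psum X k else cst 0) ->
  P (face_event n (psum X) J) =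
  (2 * gaps J d / (n - J d.+1 + J 1%N + 1)%:R)%:E.
Proof.
move=> dn cJ eX gX [Y [eY SY Y0]].
have psumY p : (p <= n)%N -> psum X p = psum Y p.
  case: p => [_|p pn]; first by apply/funext => w; rewrite /psum !big_nil.
  by have := SY p.+1; rewrite pn => <-//; lia.
have J1d : (J 1%N <= J d.+1)%N by apply: (chain_le cJ).
have Jdn := cJ.2.
have exch := law_exchangeable eY.
(* The sequence of sums is the constant 0 at index [n.+1], so the polygon closes for every
   outcome. *)
have mu0 : law n.+1 Y [set x | walk (steps x) n.+1 <> 0] = 0%E.
  rewrite lawE (_ : _ @^-1` _ = set0) ?measure0//.
  apply/seteqP; split=> w //=; rewrite walk_config//; apply.
  by have := SY n.+1; rewrite ltnn leqnn /= => /(_ isT) <-.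
set F := fun j => pr (law n.+1 Y) [set x | facet n (walk (steps x)) (slide J j)].
have Fconst j : (j <= n - (J d.+1 - J 1%N))%N -> F j = F 0%N.
  elim: j => [_|j IH jn]; first by [].
  by rewrite -(IH (ltnW jn)); exact: (bridge_shift cJ jn exch mu0).
have Jn k : (1 <= k <= d.+1)%N -> (J k <= n)%N by move=> kd; apply: (chain_leq cJ).
have shn j k : (j <= n - (J d.+1 - J 1%N))%N -> (1 <= k <= d.+1)%N -> (slide J j k <= n)%N.
  by move=> jn kd; apply: (chain_leq (chain_shift cJ jn)).
have eqF : P (face_event n (psum X) J) = (F (J 1%N))%:E.
  rewrite (face_eventE (leqnSn n) psumY Jn); congr (pr _ _)%:E.
  apply/funext => x; apply/propext; apply: eq_facet => // k kd.
  by rewrite /slide subnKC//; apply: (chain_le cJ); lia.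
rewrite eqF Fconst; last by lia.
have := sum_face_probability dn cJ eX gX.
have nE : (n - J d.+1 + J 1%N = n - (J d.+1 - J 1%N))%N by lia.
rewrite (eq_big_nat _ _ (F2 := fun=> (F 0%N)%:E)); last first.
  move=> j /andP[_]; rewrite ltnS nE => jn.
  by rewrite (face_eventE (leqnSn n) psumY (shn j ^~ jn)) -(Fconst j jn).
rewrite sumEFin sumr_const_nat subn0 => -[].
rewrite addn1 => <-; rewrite -[_ *+ _]mulr_natr mulfK// pnatr_eq0.
Qed.

End face_probability.

(** * Independent symmetric steps *)

Section boxes.
Context {R : realType} {dV : measure_display} {V : measurableType dV} {n : nat}.

Definition box (B : 'I_n -> set V) : set (n.-tuple V) :=
  [set t | forall i, B i (tnth t i)].

Lemma measurable_box B : (forall i, measurable (B i)) -> measurable (box B).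
Proof.
move=> mB; rewrite (_ : box B = \bigcap_(i in [set: 'I_n]) (@tnth n V ^~ i @^-1` B i)).
  apply: fin_bigcap_measurable => [|i _]; first exact: finite_finset.
  by rewrite -[X in measurable X]setTI; exact: measurable_tnth.
by apply/seteqP; split=> t H i; [move=> _|]; exact: H.
Qed.

(** Boxes are closed under intersection and generate the product sigma-algebra. *)
Lemma boxes_measure_unique (m1 m2 : {measure set (n.-tuple V) -> \bar R}) :
  (forall B, (forall i, measurable (B i)) -> m1 (box B) = m2 (box B)) ->
  (m1 setT < +oo)%E -> forall A, measurable A -> m1 A = m2 A.
Proof.
move=> m12 m1oo A mA.
pose G := [set A | exists2 B : 'I_n -> set V, (forall i, measurable (B i)) & A = box B].
have GT : G setT by exists (fun=> setT) => //; apply/seteqP; split.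
apply: (measure_unique G (fun=> setT)) => //.
- apply/seteqP; split.
    apply: smallest_sub; first exact: smallest_sigma_algebra.
    move=> B; rewrite -bigcup_seq => -[i _ [Y mY <-]]; apply: sub_sigma_algebra.
    exists (fun j => if j == i then Y else setT); first by move=> j; case: ifP.
    apply/seteqP; split=> t /=; rewrite /box /=.
      by move=> [_ Yt] j; case: eqP => // ->.
    by move=> H; split=> //; have := H i; rewrite eqxx.
  apply: smallest_sub; first exact: sigma_algebra_measurable.
  by move=> _ [B mB ->]; exact: measurable_box.
- move=> _ _ [B mB ->] [B' mB' ->]; exists (fun i => B i `&` B' i).
    by move=> i; exact: measurableI.
  apply/seteqP; split=> t /=; first by move=> [h h'] i; split.
  by move=> h; split=> i; have [] := h i.
- by apply/seteqP; split=> // t _; exists 0%N.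
- by move=> _ [B mB ->]; exact: m12.
Qed.

End boxes.

Section iid.
Context {R : realType} {d : nat} {disp : measure_display}.
Context {T : measurableType disp} (P : probability T R).
Local Notation V := 'rV[R]_d.+1.
Variable X : nat -> {RV P >-> V}.
Hypothesis iidX : iid P X.

Lemma law1 k B : (1 <= k)%N -> measurable B -> P (X k @^-1` B) = P (X 1%N @^-1` B).
Proof. by move=> k1 mB; apply: iidX.1. Qed.

Lemma box_probability n (r : 'I_n -> nat) (B : 'I_n -> set V) :
  injective r -> (forall i, (1 <= r i)%N) -> (forall i, measurable (B i)) ->
  P [set w | forall i, B i (X (r i) w)] = (\prod_i P (X 1%N @^-1` B i))%E.
Proof.
move=> rinj r1 mB.
(* Independence is stated for sets indexed by the labels of the steps, so the sets indexed by
   positions are carried along the injection [r], with [setT] elsewhere. *)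
pose B' k := if [pick i | r i == k] is Some i then B i else setT.
have B'E i : B' (r i) = B i.
  rewrite /B'; case: pickP => [j /eqP/rinj -> //|/(_ i)].
  by rewrite eqxx.
have := iidX.2 [seq r i | i <- enum 'I_n] B'.
move=> /(_ _ _ _)/wrap[|||].
- by rewrite map_inj_uniq// enum_uniq.
- by move=> k /mapP[i _ ->].
- by move=> k; rewrite /B'; case: pickP.
rewrite big_map big_enum/= => E.
transitivity (\prod_i P (X (r i) @^-1` B' (r i)))%E; last first.
  by apply: eq_bigr => i _; rewrite B'E law1.
rewrite -E; congr (P _); apply/seteqP; split=> w /=.
  by move=> H _ /= /mapP[i _ ->]; rewrite /= B'E.
move=> H i; rewrite -B'E; apply: (H (r i)).
by apply/mapP; exists i => //; rewrite mem_enum.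
Qed.

Lemma law_unique n (F1 F2 : T -> n.-tuple V) :
  measurable_fun setT F1 -> measurable_fun setT F2 ->
  (forall B, (forall i, measurable (B i)) -> P (F1 @^-1` box B) = P (F2 @^-1` box B)) ->
  forall A, measurable A -> P (F1 @^-1` A) = P (F2 @^-1` A).
Proof.
move=> mF1 mF2 H.
pose f1 : {mfun T >-> n.-tuple V} := HB.pack F1 (isMeasurableFun.Build _ _ _ _ F1 mF1).
pose f2 : {mfun T >-> n.-tuple V} := HB.pack F2 (isMeasurableFun.Build _ _ _ _ F2 mF2).
move=> A mA.
apply: (@boxes_measure_unique R _ V n (distribution P f1) (distribution P f2)) => //.
by rewrite -ge0_fin_numE ?measure_ge0//; exact: fin_num_measure.
Qed.

Lemma iid_relabel n f : permutes n f -> invariant_under (law n X) (relabel f).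
Proof.
move=> nf A mA; have [s fs] := permutesP nf; rewrite !lawE.
rewrite (_ : config n X @^-1` _ = (relabel f \o config n X) @^-1` A)//.
apply: law_unique => [||B mB|//].
- apply: measurableT_comp; [exact: measurable_relabel|exact: measurable_config].
- exact: measurable_config.
transitivity (\prod_i P (X 1%N @^-1` B i))%E.
  rewrite -(box_probability (r := fun i => (s i).+1))//; last first.
    by move=> i j [] /val_inj/perm_inj.
  congr (P _); apply/seteqP; split=> w /= H i; have := H i;
    by rewrite tnth_mktuple fs steps_config.
rewrite -(box_probability (r := fun i : 'I_n => i.+1))//; last first.
  by move=> i j [] /val_inj.
by congr (P _); apply/seteqP; split=> w /= H i; have := H i; rewrite tnth_mktuple.
Qed.

Hypothesis symX : same_law P (X 1%N) (fun w => - X 1%N w).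

(** On boxes the reflection permutes the factors and replaces those inside the window by their
    opposites, which have the same mass under a symmetric law. *)
Lemma iid_flip n o a : (o + a <= n)%N -> invariant_under (law n X) (flip_window o a).
Proof.
move=> oan A mA; have [s ms] := permutesP (permutes_mirror oan); rewrite !lawE.
rewrite (_ : config n X @^-1` _ = (flip_window o a \o config n X) @^-1` A)//.
apply: law_unique => [||B mB|//].
- apply: measurableT_comp; [exact: measurable_flip|exact: measurable_config].
- exact: measurable_config.
have mN (D : set V) : measurable D -> measurable ((fun v : V => - v) @^-1` D).
  move=> mD; rewrite -[X in measurable X]setTI.
  have : measurable_fun setT (fun v : V => - v) by apply: measurable_rVN; exact: measurable_id.
  by move=> /(_ measurableT _ mD).
transitivity (\prod_i P (X 1%N @^-1` B i))%E.
  transitivity (\prod_(i < n) P (X 1%N @^-1`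
      (if (o <= i < o + a)%N then (fun v : V => - v)%R @^-1` B i else B i)))%E;
    last first.
    apply: eq_bigr => i _; case: ifP => // _.
    by rewrite (symX (mB i)).
  rewrite -(box_probability (r := fun i => (s i).+1))//; last 2 first.
  - by move=> i j [] /val_inj/perm_inj.
  - by move=> i; case: ifP => // _; exact: mN.
  have E w i : tnth (flip_window o a (config n X w)) i =
      if (o <= i < o + a)%N then - X (s i).+1 w else X (s i).+1 w.
    rewrite tnth_mktuple /reflect_steps ms steps_config// -ms /mirror.
    by case: (o <= i < o + a)%N; rewrite ?steps_config.
  congr (P _); apply/seteqP; split=> w /= H i; have := H i;
    by rewrite E; case: ifP.
rewrite -(box_probability (r := fun i : 'I_n => i.+1))//; last first.
  by move=> i j [] /val_inj.
by congr (P _); apply/seteqP; split=> w /= H i; have := H i; rewrite tnth_mktuple.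
Qed.

End iid.

(** * General position of i.i.d. steps *)

Section fubini_null.
Context {R : realType} {d1 d2 : measure_display}.
Context {T1 : measurableType d1} {T2 : measurableType d2}.

(** The measure of a section is 0 off [N] and at most 1 on it, so integrating it bounds the product
    measure of [K] by [m1 N]. *)
Lemma product_measure_null (m1 : probability T1 R) (m2 : probability T2 R)
    (K : set (T1 * T2)) (N : set T1) :
  measurable K -> measurable N -> m1 N = 0%E ->
  (forall x, ~ N x -> m2 (xsection K x) = 0%E) -> (m1 \x m2)%E K = 0%E.
Proof.
move=> mK mN N0 Knull; apply/eqP; rewrite eq_le measure_ge0 andbT.
rewrite -N0 -(setIT N) -(integral_indic m1 measurableT mN).
apply: ge0_le_integral => //.
- exact: measurable_fun_xsection.
- by apply/measurable_EFinP; exact: measurable_indic.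
move=> x _ /=; rewrite indicE; have [Nx|Nx] := boolP (x \in N).
  by apply: probability_le1; exact: measurable_xsection.
by rewrite Knull// => /mem_set; exact/negP.
Qed.

End fubini_null.

Section independence.
Context {R : realType} {d : nat} {disp : measure_display}.
Context {T : measurableType disp} (P : probability T R).
Local Notation V := 'rV[R]_d.+1.
Variable X : nat -> {RV P >-> V}.
Hypothesis iidX : iid P X.

(** For fixed [E] both sides are finite measures in [A] that agree on boxes. *)
Lemma law_next t (A : set (t.-tuple V)) (E : set V) :
  measurable A -> measurable E ->
  P ((config t X @^-1` A) `&` (X t.+1 @^-1` E)) =
  (law t X A * P (X 1%N @^-1` E))%E.
Proof.
move=> mA mE.
have mXE k : measurable (X k @^-1` E).
  by rewrite -[Z in measurable Z]setTI; exact: measurable_funPT.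
have mcfg : measurable_fun setT (config t X) by exact: measurable_config.
pose m1 : {measure set (t.-tuple V) -> \bar R} :=
  measure_function_pushforward__canonical__measure_function_Measure
    (mrestr P (mXE t.+1)) mcfg.
have p0 : 0 <= fine (P (X 1%N @^-1` E)) by apply: fine_ge0.
pose m2 : {measure set (t.-tuple V) -> \bar R} := mscale (NngNum p0) (law t X).
have pE : (fine (P (X 1%N @^-1` E)))%:E = P (X 1%N @^-1` E).
  by rewrite fineK// fin_num_measure.
suff : m1 A = m2 A.
  by rewrite /m1 /m2 /= /pushforward /mrestr /mscale /= pE muleC.
apply: boxes_measure_unique => // [B mB|]; last first.
  rewrite /m1 /= /pushforward /mrestr /= -ge0_fin_numE//.
  by rewrite fin_num_measure//; apply: measurableI => //; rewrite preimage_setT.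
rewrite /m1 /m2 /= /pushforward /mrestr /mscale /= pE.
have -> : law t X (box B) = (\prod_i P (X 1%N @^-1` B i))%E.
  rewrite lawE -(box_probability iidX (r := fun i : 'I_t => i.+1))//; last first.
    by move=> i j [] /val_inj.
  by congr (P _); apply/seteqP; split=> w /= H i; have := H i; rewrite tnth_mktuple.
pose B' (i : 'I_t.+1) : set V := if unlift ord_max i is Some j then B j else E.
have B'w (j : 'I_t) : B' (widen_ord (leqnSn t) j) = B j.
  have -> : widen_ord (leqnSn t) j = lift ord_max j.
    by apply: val_inj; rewrite /= /bump leqNgt ltn_ord.
  by rewrite /B' liftK.
have B'm : B' ord_max = E by rewrite /B' unlift_none.
have := box_probability iidX (r := fun i : 'I_t.+1 => i.+1) (B := B').
move=> /(_ _ _ _)/wrap[|||].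
- by move=> i j [] /val_inj.
- by [].
- by move=> i; rewrite /B'; case: unliftP.
rewrite big_ord_recr /= B'm => E1.
rewrite (eq_bigr (fun i => P (X 1%N @^-1` B i))) in E1; last by move=> i _; rewrite B'w.
rewrite muleC -E1; congr (P _); apply/seteqP; split=> w /=.
  move=> [Bw Ew] i; rewrite /B'; case: unliftP => [j ->|-> //].
  by have := Bw j; rewrite tnth_mktuple /= /bump leqNgt ltn_ord.
move=> H; split; last by have := H ord_max; rewrite B'm.
by move=> j; rewrite tnth_mktuple -B'w; exact: H.
Qed.

Lemma independent_null t (K : set (t.-tuple V * V)) (N : set (t.-tuple V)) :
  measurable K -> measurable N -> law t X N = 0%E ->
  (forall z, ~ N z -> P (X 1%N @^-1` xsection K z) = 0%E) ->
  P ((fun w => (config t X w, X t.+1 w)) @^-1` K) = 0%E.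
Proof.
move=> mK mN N0 Knull.
have mF : measurable_fun setT (fun w => (config t X w, X t.+1 w)).
  by apply: measurable_fun_pair; [exact: measurable_config|exact: measurable_funPT].
pose F : {mfun T >-> (t.-tuple V * V)%type} :=
  HB.pack (fun w => (config t X w, X t.+1 w)) (isMeasurableFun.Build _ _ _ _ _ mF).
have := product_measure_unique (m1 := law t X) (m2 := distribution P (X 1%N))
  (m' := distribution P F).
move=> /(_ _ K mK)/wrap[A E mA mE|]; first exact: law_next.
by move=> KE; rewrite -[LHS]KE; apply: (product_measure_null mK mN N0).
Qed.

Hypothesis hyperplane_null : forall (u : 'cV[R]_d.+1) (c : R), u != 0 ->
  P (X 1%N @^-1` hyperplane u c) = 0%E.

(** This interpolates between the identity matrix at [t = 0], of determinant 1, and, once [t]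
    exceeds every [J k], the matrix whose invertibility general position requires. *)
Definition mixed_rows (S : nat -> V) (J : 'I_d.+1 -> nat) t : 'M[R]_d.+1 :=
  \matrix_(k < d.+1) if (J k < t)%N then S (J k).+1 else row k 1%:M.

Lemma eq_mixed_rows S S' J t : (forall p, (p <= t)%N -> S p = S' p) ->
  mixed_rows S J t = mixed_rows S' J t.
Proof. by move=> SS'; apply/row_matrixP => k; rewrite !rowK; case: ifP => // /SS'. Qed.

Lemma measurable_det_mixed d0 (T0 : measurableType d0) (S : nat -> T0 -> V) J t :
  (forall p, (p <= t)%N -> measurable_fun setT (S p)) ->
  measurable [set x | \det (mixed_rows (S ^~ x) J t) = 0].
Proof.
move=> mS; apply: measurable_eqr; last exact: measurable_cst.
apply: measurable_det => i j; under eq_fun do rewrite mxE.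
case: (ltnP (J i) t) => Jt; last exact: measurable_cst.
by have /measurable_rVP := mS _ Jt; exact.
Qed.

(* The steps are revealed one at a time: replacing the row [k] of the identity
   matrix by [S (t + 1) = S t + X (t + 1)] confines [X (t + 1)] to a hyperplane
   determined by the previous steps. *)
Lemma det_mixed_null (J : 'I_d.+1 -> nat) t : injective J ->
  P [set w | \det (mixed_rows (psum X ^~ w) J t) = 0] = 0%E.
Proof.
move=> Jinj; elim: t => [|t IH].
  rewrite (_ : [set w | _] = set0) ?measure0//.
  apply/seteqP; split=> w //=; rewrite (_ : mixed_rows _ J 0 = 1%:M).
    by rewrite det1 => /eqP; rewrite oner_eq0.
  by apply/row_matrixP => k; rewrite rowK.
have [/existsP[k0 /eqP Jk0]|noJ] := boolP [exists k, J k == t]; last first.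
  rewrite (_ : [set w | _] = [set w | \det (mixed_rows (psum X ^~ w) J t) = 0])//.
  apply/funext => w; congr (\det _ = _); apply/row_matrixP => k; rewrite !rowK.
  rewrite ltnS leq_eqVlt; have /negbTE -> // : J k != t.
  by apply: contra noJ => Jk; apply/existsP; exists k.
pose M (z : t.-tuple V) := mixed_rows (walk (steps z)) J t.
pose M' (zv : t.-tuple V * V) : 'M[R]_d.+1 := \matrix_(k < d.+1)
  if k == k0 then walk (steps zv.1) t + zv.2 else row k (M zv.1).
pose K := [set zv | \det (M' zv) = 0].
pose N := [set z | \det (M z) = 0].
have mN : measurable N.
  apply: (measurable_det_mixed (S := fun p z => walk (steps z) p)) => p _.
  exact: measurable_walk_steps.
have mK : measurable K.
  apply: measurable_eqr; last exact: measurable_cst.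
  apply: measurable_det => i j; under eq_fun do rewrite mxE.
  case: (i == k0).
    have : measurable_fun setT (fun zv : t.-tuple V * V => walk (steps zv.1) t + zv.2).
      apply: measurable_rVD => //.
      by apply: (measurableT_comp (@measurable_walk_steps R d t t)).
    by move=> /measurable_rVP; exact.
  under eq_fun do rewrite !mxE.
  case: (ltnP (J i) t) => _; last exact: measurable_cst.
  have : measurable_fun setT (fun zv : t.-tuple V * V => walk (steps zv.1) (J i).+1).
    by apply: (measurableT_comp (@measurable_walk_steps R d t (J i).+1)).
  by move=> /measurable_rVP; exact.
rewrite (_ : [set w | _] = (fun w => (config t X w, X t.+1 w)) @^-1` K); last first.
  apply/funext => w; rewrite /preimage /=; congr (\det _ = _).
  apply/row_matrixP => k; rewrite !rowK /=; case: eqP => [->|kk0].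
    by rewrite Jk0 ltnSn walk_config// /psum big_nat_recr.
  rewrite ltnS leq_eqVlt; case: eqP => [Jk|_] /=.
    by have := Jinj k k0; rewrite Jk Jk0 => /(_ erefl).
  by case: ifP => // Jt; rewrite walk_config.
apply: (independent_null mK mN).
  rewrite lawE -[RHS]IH; congr (P _); apply/funext => w; rewrite /preimage /=.
  congr (\det _ = _); apply: eq_mixed_rows => p pt; exact: walk_config.
(* As a function of row [k0] the determinant is the linear form [c]. It is nonzero because it does
   not vanish on the identity row that [M z] has there, so [c] is the normal of the hyperplane that
   confines the new step. *)
move=> z Nz; pose c : 'cV[R]_d.+1 := \col_j cofactor (M z) k0 j.
have M'E v : \det (M' (z, v)) = height c (walk (steps z) t + v).
  rewrite (expand_det_row _ k0) heightE; apply: eq_bigr => j _.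
  rewrite [M' _ _ _]mxE [c _ _]mxE eqxx /cofactor; congr (_ * (_ * \det _)).
  by apply/matrixP => a b; rewrite !mxE eq_sym (negbTE (neq_lift _ _)) !mxE.
have c0 : c != 0.
  apply/eqP => c0; apply: Nz; rewrite /N /= (expand_det_row _ k0) big1// => j _.
  by have /colP/(_ j) := c0; rewrite !mxE => ->; rewrite mulr0.
rewrite -(hyperplane_null (- height c (walk (steps z) t)) c0); congr (P _).
apply/seteqP; split=> w /=; rewrite /hyperplane /= -/(height _ _).
  by move=> /xsectionP; rewrite /K /= M'E heightD; lra.
by move=> h; apply/xsectionP; rewrite /K /= M'E heightD h; lra.
Qed.

Lemma iid_in_position n : law n X (~` in_position) = 0%E.
Proof.
rewrite lawE.
pose D := [pred J : {ffun 'I_d.+1 -> 'I_n} | injectiveb J].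
pose F (J : {ffun 'I_d.+1 -> 'I_n}) :=
  [set w | \det (mixed_rows (psum X ^~ w) (fun k => J k) n) = 0].
have mS p : measurable_fun setT (psum X p : T -> V).
  rewrite (_ : psum X p = fun w => walk (steps (config p X w)) p); last first.
    by apply/funext => w; rewrite walk_config.
  exact: (measurableT_comp (measurable_walk_steps p) (measurable_config X)).
have E (J : 'I_d.+1 -> 'I_n) w : mixed_rows (psum X ^~ w) (fun k => J k) n =
    \matrix_(k < d.+1) walk (steps (config n X w)) (J k).+1.
  by apply/row_matrixP => k; rewrite !rowK ltn_ord walk_config.
have F0 J : J \in D -> measurable (F J) /\ P (F J) = 0%E.
  rewrite inE => /injectiveP Jinj; split.
    by apply: measurable_det_mixed => p _; exact: mS.
  by apply: det_mixed_null => k l /val_inj/Jinj.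
have := measure_fin_bigcup0 (mu := P) F0.
suff -> : config n X @^-1` (~` in_position) = \bigcup_(J in [set` D]) F J by [].
apply/seteqP; split=> w /=.
  move=> nI; apply: contra_notP nI => H J Jinj.
  rewrite row_free_unit unitmxE unitfE; apply/eqP => J0; apply: H.
  exists [ffun k => J k].
    by rewrite /= inE; apply/injectiveP => k l; rewrite !ffunE => /Jinj.
  rewrite /F /= -[RHS]J0 -E; congr (\det _); apply/row_matrixP => k.
  by rewrite !rowK ffunE.
move=> [J JD J0] I; have /injectiveP Jinj : injectiveb J by [].
have := I J Jinj; rewrite row_free_unit unitmxE unitfE -E.
by rewrite (J0 : \det _ = 0) eqxx.
Qed.

End independence.

Lemma gapsE {R : realType} (J : nat -> nat) d :
  gaps J d = (\prod_(1 <= k < d.+1) (J k.+1 - J k)%:R)^-1 :> R.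
Proof. by rewrite /gaps prodfV. Qed.

Theorem proposition1 (R : realType) (d n : nat) (i : nat -> nat)
    (disp : measure_display) (T : measurableType disp) (P : probability T R)
    (X : nat -> {RV P >-> 'rV[R]_d})
    (hd : (1 <= d)%N) (hn : (d <= n)%N)
    (hi : forall k, (1 <= k < d)%N -> (i k < i k.+1)%N)
    (hin : (i d <= n)%N) :
  (exchangeable P n X ->
   {ae P, forall w, general_position n (psum X ^~ w)} ->
   (\sum_(0 <= j < (n - i d + i 1%N).+1)
      P (face_event n (psum X) (fun k => (j + (i k - i 1%N))%N)))%E =
     (2 / \prod_(1 <= k < d) (i k.+1 - i k)%:R)%:E /\
   (random_bridge P n.+1 (fun k => if (k <= n)%N then psum X k else cst 0) ->
    P (face_event n (psum X) i) =
      (2 / ((\prod_(1 <= k < d) (i k.+1 - i k)%:R)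
            * (n - i d + i 1%N + 1)%:R))%:E)) /\
  (iid P X ->
   (forall (u : 'cV[R]_d) (c : R), u != 0 ->
      P (X 1%N @^-1` hyperplane u c) = 0%E) ->
   same_law P (X 1%N) (fun w => - X 1%N w) ->
   P (face_event n (psum X) i) =
     (2 * ((dfact (2 * i 1%N - 1))%:R / (dfact (2 * i 1%N))%:R)
        * ((dfact (2 * n - 2 * i d - 1))%:R / (dfact (2 * n - 2 * i d))%:R)
        * \prod_(1 <= k < d) ((i k.+1 - i k)%:R)^-1)%:E).
Proof.
case: d => // d in X hd hn hi hin *.
have ci : chain (d := d) n i by split.
split=> [eX gX|iidX hypX symX].
  split=> [|bX]; first by rewrite (sum_face_probability hn ci eX gX) gapsE.
  rewrite (bridge_face_probability hn ci eX gX bX) gapsE invfM.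
  by rewrite [in RHS]mulrA.
have exch := @iid_relabel _ _ _ _ P X iidX n.
have muG := generic_set_full exch (iid_in_position iidX hypX n).
have in_n k : (1 <= k <= d.+1)%N -> (i k <= n)%N by exact: chain_leq.
rewrite (face_eventE (leqnn n) (fun p _ => erefl) in_n).
rewrite (pr_facet_symmetric exch (measurable_generic_set) muG) //; last first.
  by move=> o a; exact: iid_flip.
by rewrite /arcsine mulnBr.
Qed.
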